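(* Let $n \geq 1$ and $m \in \{2n+1, 2n+2\}$. Let $k_0 \geq m-1$ and $s_0 \geq -1$ be integers such that $\Omega^{(m)}_{k_0,s_0} \neq 0$. Then \[ \left(\Omega^{(m)}_{k_0,s_0}\right) = \ker \Psi_n = \mathrm{U}(W_{\geq -1})\, \{\Omega^{(m)}_{k,s} \mid k \geq m-1,\ s \geq -1\},\] where the last expression denotes the left ideal of $\mathrm U(W_{\geq -1})$ generated by the given set.
   Context: Let $\Bbbk$ be a field of characteristic $0$; all algebras are unital $\Bbbk$-algebras and $\otimes=\otimes_\Bbbk$. The one-sided Witt algebra is the Lie algebra $W_{\geq -1}=\Bbbk[t]\partial$, $\partial=\frac{d}{dt}$, with bracket $[f\partial,g\partial]=(fg'-f'g)\partial$. It has basis $e_i=t^{i+1}\partial$ ($i\geq -1$). For $n\ge -1$ let $W_{\geq n}=\mathrm{span}_\Bbbk\{e_i\mid i\geq n\}$. For $n\geq 0$ let $\mathfrak g_n=W_{\geq 0}/W_{\geq n}$, with basis $v_i=e_i+W_{\geq n}$, $0\leq i\leq n-1$. $\mathrm U(\cdot)$ denotes the universal enveloping algebra. $A_1$ is the first Weyl algebra, generated by $t,\partial$ with $\partial t-t\partial=1$, and $T_n=A_1\otimes \mathrm U(\mathfrak g_n)$. The $n$th orbit homomorphism is the algebra homomorphism $\Psi_n:\mathrm U(W_{\geq -1})\to T_n$ determined by $\Psi_n(f\partial)=f\partial+\sum_{i=0}^{n-1}\frac{f^{(i+1)}}{(i+1)!}v_i$ for $f\in\Bbbk[t]$. For integers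 $m\geq 0$, $s\geq -1$, $k\geq m-1$, the differentiator is $\Omega^{(m)}_{k,s}=\sum_{i=0}^m(-1)^i\binom{m}{i}e_{k-i}e_{s+i}\in\mathrm U(W_{\geq -1})$. $(x)$ denotes the two-sided ideal of $\mathrm U(W_{\geq -1})$ generated by $x$. *)

(* Defs.v *)
From HB Require Import structures.
From mathcomp Require Import all_boot all_order all_algebra ring_quotient.
From mathcomp Require Import ring.
From mathcomp Require Import boolp classical_sets.

Set Implicit Arguments.
Unset Strict Implicit.
Unset Printing Implicit Defensive.

Import Order.TTheory GRing.Theory Num.Theory.
Local Open Scope ring_scope.
Local Open Scope classical_set_scope.

(* Noncommutative polynomial expressions with coefficients in [k]; the
   presented algebra is their quotient by the congruence [presentation_eq]
   generated by the axioms of unital associative k-algebras and by [rel]. *)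
Inductive alg_expr (k X : Type) : Type :=
| Gen of X
| Cst of k
| Add of alg_expr k X & alg_expr k X
| Mul of alg_expr k X & alg_expr k X.
Arguments Gen {k X} _.
Arguments Cst {k X} _.

Section Presentation.
Variables (k : fieldType) (X : Type).
Local Notation expr := (alg_expr k X).
Variable (rel : expr -> expr -> Prop).

Inductive presentation_eq : expr -> expr -> Prop :=
| PEq_rel s t : rel s t -> presentation_eq s t
| PEq_refl s : presentation_eq s s
| PEq_sym s t : presentation_eq s t -> presentation_eq t s
| PEq_trans s t u :
    presentation_eq s t -> presentation_eq t u -> presentation_eq s u
| PEq_add s s' t t' : presentation_eq s s' -> presentation_eq t t' ->
    presentation_eq (Add s t) (Add s' t')
| PEq_mul s s' t t' : presentation_eq s s' -> presentation_eq t t' ->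
    presentation_eq (Mul s t) (Mul s' t')
| PEq_addA s t u : presentation_eq (Add s (Add t u)) (Add (Add s t) u)
| PEq_addC s t : presentation_eq (Add s t) (Add t s)
| PEq_add0 s : presentation_eq (Add (Cst 0) s) s
| PEq_mulA s t u : presentation_eq (Mul s (Mul t u)) (Mul (Mul s t) u)
| PEq_mul1 s : presentation_eq (Mul (Cst 1) s) s
| PEq_mul0 s : presentation_eq (Mul (Cst 0) s) (Cst 0)
| PEq_mulDl s t u :
    presentation_eq (Mul (Add s t) u) (Add (Mul s u) (Mul t u))
| PEq_mulDr s t u :
    presentation_eq (Mul s (Add t u)) (Add (Mul s t) (Mul s u))
| PEq_cstD a b : presentation_eq (Cst (a + b)) (Add (Cst a) (Cst b))
| PEq_cstM a b : presentation_eq (Cst (a * b)) (Mul (Cst a) (Cst b))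
| PEq_cstC a s : presentation_eq (Mul (Cst a) s) (Mul s (Cst a)).

HB.instance Definition _ := gen_eqMixin expr.
HB.instance Definition _ := gen_choiceMixin expr.

Definition presentation_eqb (s t : expr) : bool := `[< presentation_eq s t >].

Lemma presentation_eqb_equiv : equiv_class_of presentation_eqb.
Proof.
split=> [s|s t|t s u].
- exact/asboolP/PEq_refl.
- by apply/asboolP/asboolP => /PEq_sym.
- by move=> /asboolP st /asboolP tu; apply/asboolP/(PEq_trans st tu).
Qed.

Canonical presentation_equiv := EquivRelPack presentation_eqb_equiv.
Canonical presentation_enc := defaultEncModRel presentation_eqb.

Definition presented : Type := {eq_quot presentation_eqb}%qT.
HB.instance Definition _ := EqQuotient.on presented.
HB.instance Definition _ := Choice.on presented.

Local Notation pi := (\pi_presented%qT : expr -> presented).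
Local Notation repr := (generic_quotient.repr : presented -> expr).

Lemma presented_eqP s t : pi s = pi t <-> presentation_eq s t.
Proof.
split=> [/eqmodP/asboolP //|st].
by apply/eqmodP/asboolP.
Qed.

Lemma presented_reprP s : presentation_eq (repr (pi s)) s.
Proof. by apply/presented_eqP; rewrite reprK. Qed.

Definition padd (x y : presented) := pi (Add (repr x) (repr y)).
Definition pmul (x y : presented) := pi (Mul (repr x) (repr y)).
Definition pscale (a : k) (x : presented) := pi (Mul (Cst a) (repr x)).

Lemma pi_add s t : pi (Add s t) = padd (pi s) (pi t).
Proof. by apply/presented_eqP/PEq_add; apply/PEq_sym/presented_reprP. Qed.

Lemma pi_mul s t : pi (Mul s t) = pmul (pi s) (pi t).
Proof. by apply/presented_eqP/PEq_mul; apply/PEq_sym/presented_reprP. Qed.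

Lemma pi_scale a s : pi (Mul (Cst a) s) = pscale a (pi s).
Proof.
apply/presented_eqP/PEq_mul; first exact: PEq_refl.
exact/PEq_sym/presented_reprP.
Qed.

Lemma presented_surj (P : presented -> Prop) :
  (forall s, P (pi s)) -> forall x, P x.
Proof. by move=> Ppi x; rewrite -[x]reprK; apply: Ppi. Qed.

Local Ltac pi_auto lem :=
  repeat (let s := fresh in refine (presented_surj _) => s);
  rewrite -?(pi_add, pi_mul, pi_scale); apply/presented_eqP; exact: lem.

Fact paddA : associative padd. Proof. pi_auto PEq_addA. Qed.
Fact paddC : commutative padd. Proof. pi_auto PEq_addC. Qed.
Fact padd0 : left_id (pi (Cst 0)) padd. Proof. pi_auto PEq_add0. Qed.
Fact paddN : left_inverse (pi (Cst 0)) (pscale (-1)) padd.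
Proof.
apply: presented_surj => s; rewrite -pi_scale -pi_add; apply/presented_eqP.
apply: (PEq_trans _ (PEq_mul0 s)).
have -> : Cst 0 = Cst (-1 + 1) :> expr by rewrite addNr.
apply: (PEq_trans _ (PEq_mul (PEq_sym (PEq_cstD _ _)) (PEq_refl s))).
apply: (PEq_trans _ (PEq_sym (PEq_mulDl _ _ _))).
exact: PEq_add (PEq_refl _) (PEq_sym (PEq_mul1 _)).
Qed.

HB.instance Definition _ := GRing.isZmodule.Build presented paddA paddC padd0 paddN.

Fact pmulA : associative pmul. Proof. pi_auto PEq_mulA. Qed.
Fact pmul1 : left_id (pi (Cst 1)) pmul. Proof. pi_auto PEq_mul1. Qed.
Fact pmul1r : right_id (pi (Cst 1)) pmul.
Proof.
pi_auto (fun s => PEq_trans (PEq_sym (PEq_cstC 1 s)) (PEq_mul1 s)).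
Qed.
Fact pmulDl : left_distributive pmul padd. Proof. pi_auto PEq_mulDl. Qed.
Fact pmulDr : right_distributive pmul padd. Proof. pi_auto PEq_mulDr. Qed.

HB.instance Definition _ :=
  GRing.Zmodule_isPzRing.Build presented pmulA pmul1 pmul1r pmulDl pmulDr.

Fact pscaleA a b x : pscale a (pscale b x) = pscale (a * b) x.
Proof.
move: x; apply: presented_surj => s; rewrite -!pi_scale; apply/presented_eqP.
apply: (PEq_trans (PEq_mulA _ _ _)).
exact: PEq_mul (PEq_sym (PEq_cstM _ _)) (PEq_refl _).
Qed.
Fact pscale1 : left_id 1 pscale. Proof. pi_auto PEq_mul1. Qed.
Fact pscaleDr : right_distributive pscale padd.
Proof. move=> a; pi_auto PEq_mulDr. Qed.
Fact pscaleDl x : {morph pscale^~ x : a b / a + b >-> padd a b}.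
Proof.
move=> a b; move: x; apply: presented_surj => s; rewrite -!pi_scale -pi_add.
apply/presented_eqP; apply: (PEq_trans _ (PEq_mulDl _ _ _)).
exact: PEq_mul (PEq_cstD _ _) (PEq_refl _).
Qed.

HB.instance Definition _ := GRing.Zmodule_isLmodule.Build k presented
  pscaleA pscale1 pscaleDr pscaleDl.

Fact presented_scalerAl a (x y : presented) : a *: (x * y) = (a *: x) * y.
Proof.
by move: x y; rewrite /GRing.scale /GRing.mul /=; pi_auto PEq_mulA.
Qed.

Fact presented_scalerAr a (x y : presented) : a *: (x * y) = x * (a *: y).
Proof.
move: x y; apply: presented_surj => s; apply: presented_surj => t.
rewrite /GRing.scale /GRing.mul /= -!(pi_mul, pi_scale).
apply/presented_eqP; apply: (PEq_trans (PEq_mulA _ _ _)).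
apply: (PEq_trans _ (PEq_sym (PEq_mulA _ _ _))).
exact: PEq_mul (PEq_cstC _ _) (PEq_refl _).
Qed.

Definition pgen (x : X) : presented := pi (Gen x).
Definition pcst (a : k) : presented := a *: (1 : presented).

Fixpoint peval (A : pzRingType) (c : k -> A) (f : X -> A) (s : expr) : A :=
  match s with
  | Gen x => f x
  | Cst a => c a
  | Add s t => peval c f s + peval c f t
  | Mul s t => peval c f s * peval c f t
  end.

Lemma peval_presented s : pi s = peval pcst pgen s.
Proof.
elim: s => //= [a|s IHs t IHt|s IHs t IHt].
- rewrite -[RHS]pi_scale; apply/presented_eqP.
  apply: (PEq_trans (PEq_sym (PEq_mul1 _))); exact/PEq_sym/PEq_cstC.
- by rewrite pi_add IHs IHt.
- by rewrite pi_mul IHs IHt.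
Qed.

Lemma presented_relP s t : rel s t ->
  peval pcst pgen s = peval pcst pgen t.
Proof. by move=> st; rewrite -!peval_presented; apply/presented_eqP/PEq_rel. Qed.

Lemma presented_ind (P : presented -> Prop) :
    (forall x, P (pgen x)) -> (forall a, P (a *: (1 : presented))) ->
    (forall x y, P x -> P y -> P (x + y)) ->
    (forall x y, P x -> P y -> P (x * y)) ->
  forall x, P x.
Proof.
move=> Pg Pc PD PM; apply: presented_surj => s; rewrite peval_presented.
by elim: s => //= s IHs t IHt; [apply: PD | apply: PM].
Qed.

Section Lift.
Variables (A : algType k) (f : X -> A).
Definition respects_relations := forall s t : expr,
  rel s t -> peval (in_alg A) f s = peval (in_alg A) f t.
Hypothesis fP : respects_relations.

Lemma peval_eq s t :
  presentation_eq s t -> peval (in_alg A) f s = peval (in_alg A) f t.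
Proof.
elim=> /= {s t} //.
- by move=> s t u _ -> _ ->.
- by move=> s s' t t' _ -> _ ->.
- by move=> s s' t t' _ -> _ ->.
- by move=> *; rewrite addrA.
- by move=> *; rewrite addrC.
- by move=> *; rewrite scale0r add0r.
- by move=> *; rewrite mulrA.
- by move=> *; rewrite scale1r mul1r.
- by move=> *; rewrite scale0r mul0r.
- by move=> *; rewrite mulrDl.
- by move=> *; rewrite mulrDr.
- by move=> *; rewrite scalerDl.
- by move=> *; rewrite -scalerAl mul1r scalerA.
- by move=> *; rewrite -scalerAl mul1r -scalerAr mulr1.
Qed.

Definition plift of respects_relations := fun x : presented =>
  peval (in_alg A) f (repr x).
Local Notation h := (plift fP).

Lemma plift_pi s : h (pi s) = peval (in_alg A) f s.
Proof. exact/peval_eq/presented_reprP. Qed.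

Fact plift_is_linear : linear h.
Proof.
move=> a; apply: presented_surj => s; apply: presented_surj => t.
rewrite -[a *: _]pi_scale -[_ + _]pi_add !plift_pi /=.
by rewrite -scalerAl mul1r.
Qed.
HB.instance Definition _ :=
  GRing.isLinear.Build k presented A _ h plift_is_linear.

Fact plift_is_monoid_morphism : monoid_morphism h.
Proof.
split; first by rewrite [LHS]plift_pi /= scale1r.
apply: presented_surj => s; apply: presented_surj => t.
by rewrite -[_ * _]pi_mul !plift_pi.
Qed.
HB.instance Definition _ :=
  GRing.isMonoidMorphism.Build presented A h plift_is_monoid_morphism.

Lemma plift_gen x : h (pgen x) = f x.
Proof. exact: plift_pi. Qed.

Lemma plift_oner_neq0 : (1 : presented) != 0.
Proof.
apply/eqP => /(congr1 h); rewrite rmorph1 raddf0 => /eqP.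
by rewrite (negPf (oner_neq0 A)).
Qed.

End Lift.

End Presentation.

HB.mixin Record Lmodule_isLieAlgebra (k : fieldType) L of GRing.Lmodule k L := {
  lie : L -> L -> L;
  lie_linearl : forall y, linear (lie^~ y);
  lie_linearr : forall x, linear (lie x);
  liexx : forall x, lie x x = 0;
  lie_jacobi : forall x y z,
    lie x (lie y z) + lie y (lie z x) + lie z (lie x y) = 0
}.

#[short(type="lieAlgType")]
HB.structure Definition LieAlgebra (k : fieldType) :=
  {L of GRing.Lmodule k L & Lmodule_isLieAlgebra k L}.

Section LieTheory.
Variables (k : fieldType) (L : lieAlgType k).
Implicit Types x y z : L.

Lemma lieDl x y z : lie (x + y) z = lie x z + lie y z.
Proof. by have := lie_linearl z 1 x y; rewrite !scale1r. Qed.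
Lemma lieDr x y z : lie x (y + z) = lie x y + lie x z.
Proof. by have := lie_linearr x 1 y z; rewrite !scale1r. Qed.
Lemma lieC x y : lie x y = - lie y x.
Proof.
apply/eqP; rewrite -addr_eq0; apply/eqP.
by have := liexx (x + y); rewrite lieDl !lieDr !liexx add0r addr0.
Qed.
Lemma lieBr x y z : lie x (y - z) = lie x y - lie x z.
Proof. by apply/eqP; rewrite eq_sym subr_eq -lieDr subrK. Qed.

End LieTheory.

Record lieIdeal (k : fieldType) (L : lieAlgType k) := LieIdeal {
  lie_ideal_pred :> {pred L};
  lie_ideal_submod : submod_closed lie_ideal_pred;
  lie_ideal_lie : forall x y : L, y \in lie_ideal_pred ->
    lie x y \in lie_ideal_pred
}.

HB.instance Definition _ (k : fieldType) (L : lieAlgType k) (I : lieIdeal L) :=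
  GRing.isSubmodClosed.Build k L (lie_ideal_pred I)
    (GRing.submod_closed_semi (lie_ideal_submod I)).

Section LieQuotient.
Variables (k : fieldType) (L : lieAlgType k) (I : lieIdeal L).

Definition lie_quot : Type := Quotient.quot I.
HB.instance Definition _ := EqQuotient.on lie_quot.
HB.instance Definition _ := GRing.Zmodule.on lie_quot.

Definition lieq (x : L) : lie_quot := \pi_(Quotient.quot I)%qT x.
Local Notation repr := (generic_quotient.repr : lie_quot -> L).

Lemma lieq_eqP x y : lieq x = lieq y <-> x - y \in I.
Proof. by rewrite Quotient.idealrBE; split=> /eqP. Qed.

Lemma lieq_surj (P : lie_quot -> Prop) : (forall x, P (lieq x)) -> forall x, P x.
Proof. by move=> Ppi x; rewrite -[x]reprK; apply: Ppi. Qed.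

Lemma lieq_reprP x : repr (lieq x) - x \in I.
Proof. by apply/lieq_eqP; rewrite /lieq reprK. Qed.

Definition lieq_scale a (x : lie_quot) := lieq (a *: repr x).
Definition lieq_lie (x y : lie_quot) := lieq (lie (repr x) (repr y)).

Lemma lieqD x y : lieq (x + y) = lieq x + lieq y.
Proof. exact: (raddfD (\pi_(Quotient.quot I)%qT : L -> Quotient.quot I)). Qed.

Lemma lieqZ a x : lieq (a *: x) = lieq_scale a (lieq x).
Proof. by apply/esym/lieq_eqP; rewrite -scalerBr rpredZ ?lieq_reprP. Qed.

Lemma lieqL x y : lieq (lie x y) = lieq_lie (lieq x) (lieq y).
Proof.
set x' := repr (lieq x); set y' := repr (lieq y).
have xI : x' - x \in I by exact: lieq_reprP.
have yI : y' - y \in I by exact: lieq_reprP.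
apply/esym/lieq_eqP; rewrite -/x' -/y'.
have -> : lie x' y' - lie x y = lie x' (y' - y) - lie y (x' - x).
  rewrite !lieBr (lieC y x') (lieC y x) opprB opprK (addrC (- _)).
  by rewrite addrA subrK.
by rewrite rpredB // lie_ideal_lie.
Qed.

Fact lieq_scaleA a b x : lieq_scale a (lieq_scale b x) = lieq_scale (a * b) x.
Proof. by move: x; apply: lieq_surj => x; rewrite -!lieqZ scalerA. Qed.
Fact lieq_scale1 : left_id 1 lieq_scale.
Proof. by apply: lieq_surj => x; rewrite -lieqZ scale1r. Qed.
Fact lieq_scaleDr : right_distributive lieq_scale +%R.
Proof.
move=> a; apply: lieq_surj => x; apply: lieq_surj => y.
by rewrite -!(lieqZ, lieqD) scalerDr.
Qed.
Fact lieq_scaleDl x : {morph lieq_scale^~ x : a b / a + b}.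
Proof. by move=> a b; move: x; apply: lieq_surj => x; rewrite -!(lieqZ, lieqD) scalerDl. Qed.
HB.instance Definition _ := GRing.Zmodule_isLmodule.Build k lie_quot
  lieq_scaleA lieq_scale1 lieq_scaleDr lieq_scaleDl.

Fact lieq_is_linear : linear lieq.
Proof. by move=> a x y; rewrite lieqD lieqZ. Qed.
HB.instance Definition _ :=
  GRing.isLinear.Build k L lie_quot _ lieq lieq_is_linear.

Fact lieq_linearl y : linear (lieq_lie^~ y).
Proof.
move=> a; apply: lieq_surj => u; apply: lieq_surj => v; move: y.
by apply: lieq_surj => y; rewrite -linearP -!lieqL -linearP lie_linearl.
Qed.
Fact lieq_linearr x : linear (lieq_lie x).
Proof.
move=> a; apply: lieq_surj => u; apply: lieq_surj => v; move: x.
by apply: lieq_surj => x; rewrite -linearP -!lieqL -linearP lie_linearr.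
Qed.
Fact lieq_liexx x : lieq_lie x x = 0.
Proof. by move: x; apply: lieq_surj => x; rewrite -lieqL liexx linear0. Qed.
Fact lieq_jacobi x y z : lieq_lie x (lieq_lie y z) + lieq_lie y (lieq_lie z x)
  + lieq_lie z (lieq_lie x y) = 0.
Proof.
move: x; apply: lieq_surj => x; move: y; apply: lieq_surj => y; move: z.
by apply: lieq_surj => z; rewrite -!lieqL -!lieqD lie_jacobi linear0.
Qed.
HB.instance Definition _ := Lmodule_isLieAlgebra.Build k lie_quot
  lieq_linearl lieq_linearr lieq_liexx lieq_jacobi.

Lemma lieq_lieE x y : lieq (lie x y) = lie (lieq x) (lieq y).
Proof. exact: lieqL. Qed.

End LieQuotient.
Arguments lieq {k L} I x.

Section Enveloping.
Variables (k : fieldType) (L : lieAlgType k).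

Inductive env_rel : alg_expr k L -> alg_expr k L -> Prop :=
| EnvD x y : env_rel (Gen (x + y)) (Add (Gen x) (Gen y))
| EnvZ a x : env_rel (Gen (a *: x)) (Mul (Cst a) (Gen x))
| EnvL x y : env_rel (Mul (Gen x) (Gen y))
                     (Add (Mul (Gen y) (Gen x)) (Gen (lie x y))).

Definition env : Type := presented env_rel.
HB.instance Definition _ := GRing.PzRing.on env.
HB.instance Definition _ := GRing.Lmodule.on env.

Fact env_oner_neq0 : (1 : env) != 0.
Proof.
suff: respects_relations env_rel (fun=> 0 : k^o) by apply: plift_oner_neq0.
move=> _ _ [x y|a x|x y] /=; by rewrite ?(addr0, mulr0).
Qed.
HB.instance Definition _ := GRing.PzSemiRing_isNonZero.Build env env_oner_neq0.
HB.instance Definition _ := GRing.LSemiModule_isLSemiAlgebra.Build k env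
  (@presented_scalerAl _ _ _).
HB.instance Definition _ := GRing.LSemiAlgebra_isSemiAlgebra.Build k env
  (@presented_scalerAr _ _ _).

Definition env_gen (x : L) : env := pgen env_rel x.

Fact env_gen_is_linear : linear env_gen.
Proof.
move=> a x y; rewrite [LHS](presented_relP (EnvD _ _)) /=; congr (_ + _).
rewrite [LHS](presented_relP (EnvZ _ _)) /= /pcst.
by rewrite -[LHS]presented_scalerAl mul1r.
Qed.
HB.instance Definition _ := GRing.isLinear.Build k L env _ env_gen env_gen_is_linear.

Lemma env_gen_lie x y : env_gen (lie x y) = env_gen x * env_gen y - env_gen y * env_gen x.
Proof.
apply/eqP; rewrite eq_sym subr_eq addrC; apply/eqP.
exact: (presented_relP (EnvL x y)).
Qed.

Section Lift.
Variables (A : algType k) (f : {linear L -> A}).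
Hypothesis fL : forall x y, f (lie x y) = f x * f y - f y * f x.

Fact env_respects : respects_relations env_rel f.
Proof.
move=> _ _ [x y|a x|x y] /=; first by rewrite linearD.
- by rewrite linearZ -scalerAl mul1r.
- by rewrite fL addrC subrK.
Qed.

Definition env_lift : env -> A := plift env_respects.
HB.instance Definition _ := GRing.RMorphism.copy env_lift (plift env_respects).
HB.instance Definition _ := GRing.Linear.copy env_lift (plift env_respects).

Lemma env_liftE x : env_lift (env_gen x) = f x.
Proof. exact: plift_gen. Qed.

Lemma env_lift_unique (h : {lrmorphism env -> A}) :
  (forall x, h (env_gen x) = f x) -> h =1 env_lift.
Proof.
move=> hE; apply: presented_ind => [x|a|x y hx hy|x y hx hy].
- by rewrite [LHS]hE [RHS]env_liftE.
- have -> : a *: (1 : presented env_rel) = a *: (1 : env) by [].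
  by rewrite !linearZ /= !rmorph1.
- exact: (etrans (raddfD h x y)
            (etrans (f_equal2 +%R hx hy) (esym (raddfD env_lift x y)))).
- exact: (etrans (rmorphM h x y)
            (etrans (f_equal2 *%R hx hy) (esym (rmorphM env_lift x y)))).
Qed.

End Lift.
End Enveloping.

Section Tensor.
Variables (k : fieldType) (A B : algType k).

(* Generators (a, b) stand for pure tensors; the first four relations are the
   bilinear ones defining the k-module A (x) B, the last two fix its unit and
   the usual product (a (x) b)(a' (x) b') = aa' (x) bb'. *)
Inductive tens_rel : alg_expr k (A * B) -> alg_expr k (A * B) -> Prop :=
| TensDl a a' b : tens_rel (Gen (a + a', b)) (Add (Gen (a, b)) (Gen (a', b)))
| TensDr a b b' : tens_rel (Gen (a, b + b')) (Add (Gen (a, b)) (Gen (a, b')))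
| TensZl c a b : tens_rel (Gen (c *: a, b)) (Mul (Cst c) (Gen (a, b)))
| TensZr c a b : tens_rel (Gen (a, c *: b)) (Mul (Cst c) (Gen (a, b)))
| Tens1 : tens_rel (Gen (1, 1)) (Cst 1)
| TensM a a' b b' :
    tens_rel (Mul (Gen (a, b)) (Gen (a', b'))) (Gen (a * a', b * b')).

Definition tens_alg : Type := presented tens_rel.
HB.instance Definition _ := GRing.PzRing.on tens_alg.
HB.instance Definition _ := GRing.Lmodule.on tens_alg.

Definition tens (a : A) (b : B) : tens_alg := pgen tens_rel (a, b).

Lemma tensDl a a' b : tens (a + a') b = tens a b + tens a' b.
Proof. exact: (presented_relP (TensDl a a' b)). Qed.
Lemma tensDr a b b' : tens a (b + b') = tens a b + tens a b'.
Proof. exact: (presented_relP (TensDr a b b')). Qed.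
Lemma tensZl c a b : tens (c *: a) b = c *: tens a b.
Proof.
rewrite [LHS](presented_relP (TensZl c a b)) /= /pcst.
by rewrite -[LHS]presented_scalerAl mul1r.
Qed.
Lemma tensZr c a b : tens a (c *: b) = c *: tens a b.
Proof.
rewrite [LHS](presented_relP (TensZr c a b)) /= /pcst.
by rewrite -[LHS]presented_scalerAl mul1r.
Qed.
Lemma tens11 : tens 1 1 = 1.
Proof. by rewrite [LHS](presented_relP Tens1) /= /pcst scale1r. Qed.
Lemma tensM a a' b b' : tens a b * tens a' b' = tens (a * a') (b * b').
Proof. exact: (presented_relP (TensM a a' b b')). Qed.

Lemma tens_span (P : tens_alg -> Prop) :
    (forall a b, P (tens a b)) -> (forall x y, P x -> P y -> P (x + y)) ->
  forall x, P x.
Proof.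
move=> Pt PD x.
suff [s ->] : exists s : seq (A * B), x = \sum_(p <- s) tens p.1 p.2.
  elim: s => [|p s IHs]; last by rewrite big_cons; apply: PD.
  by rewrite big_nil -(scale0r (tens 0 0)) -tensZl.
move: x; apply: presented_ind => [[a b]|c|_ _ [s ->] [t ->]|_ _ [s ->] [t ->]].
- by exists [:: (a, b)]; rewrite big_seq1.
- by exists [:: (c *: 1, 1)]; rewrite big_seq1 /= tensZl tens11.
- by exists (s ++ t); rewrite big_cat.
- exists [seq (p.1 * q.1, p.2 * q.2) | p <- s, q <- t].
  rewrite big_allpairs_dep [LHS]mulr_suml; apply: eq_bigr => p _.
  by rewrite mulr_sumr; apply: eq_bigr => q _; rewrite tensM.
Qed.

Section Lift.
Variables (C : algType k) (f : {lrmorphism A -> C}) (g : {lrmorphism B -> C}).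
Hypothesis fgC : forall a b, f a * g b = g b * f a.

Fact tens_respects : respects_relations tens_rel (fun p => f p.1 * g p.2).
Proof.
move=> _ _ [a a' b|a b b'|c a b|c a b||a a' b b'] /=.
- by rewrite linearD mulrDl.
- by rewrite linearD mulrDr.
- by rewrite linearZ /= -!scalerAl mul1r.
- by rewrite linearZ /= -scalerAr -scalerAl mul1r.
- by rewrite !rmorph1 mulr1 scale1r.
- by rewrite !rmorphM !mulrA -(mulrA (f a)) -fgC !mulrA.
Qed.

Definition tens_lift : tens_alg -> C := plift tens_respects.
HB.instance Definition _ := GRing.RMorphism.copy tens_lift (plift tens_respects).
HB.instance Definition _ := GRing.Linear.copy tens_lift (plift tens_respects).

Lemma tens_liftE a b : tens_lift (tens a b) = f a * g b.
Proof. exact: plift_gen. Qed.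

End Lift.
End Tensor.

Section Weyl.
Variable k : fieldType.

Inductive weyl_gen := WeylT | WeylD.

Inductive weyl_rel : alg_expr k weyl_gen -> alg_expr k weyl_gen -> Prop :=
| WeylDT : weyl_rel (Mul (Gen WeylD) (Gen WeylT))
                    (Add (Mul (Gen WeylT) (Gen WeylD)) (Cst 1)).

Definition weyl : Type := presented weyl_rel.
HB.instance Definition _ := GRing.PzRing.on weyl.
HB.instance Definition _ := GRing.Lmodule.on weyl.

(* Action on k[t] by multiplication and derivation, used to show 1 != 0. *)
Fixpoint weyl_act (s : alg_expr k weyl_gen) (p : {poly k}) : {poly k} :=
  match s with
  | Gen WeylT => p * 'X
  | Gen WeylD => p^`()
  | Cst a => a *: p
  | Add s t => weyl_act s p + weyl_act t p
  | Mul s t => weyl_act s (weyl_act t p)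
  end.

Fact weyl_act_is_linear s : linear (weyl_act s).
Proof.
elim: s => [[]|a|s IHs t IHt|s IHs t IHt] c p q /=.
- by rewrite mulrDl scalerAl.
- exact: linearP.
- by rewrite scalerDr !scalerA mulrC.
- by rewrite IHs IHt scalerDr addrACA.
- by rewrite IHt IHs.
Qed.

Lemma weyl_act_eq s t :
  presentation_eq weyl_rel s t -> weyl_act s =1 weyl_act t.
Proof.
have actD u p q : weyl_act u (p + q) = weyl_act u p + weyl_act u q.
  by have := weyl_act_is_linear u 1 p q; rewrite !scale1r.
have actZ u a p : weyl_act u (a *: p) = a *: weyl_act u p.
  have act0 : weyl_act u 0 = 0.
    by apply/(addrI (weyl_act u 0)); rewrite -actD !addr0.
  by have := weyl_act_is_linear u a p 0; rewrite act0 !addr0.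
elim=> {s t} //=.
- by move=> _ _ [] p /=; rewrite derivM derivX mulr1 scale1r.
- by move=> s t _ IH p; rewrite IH.
- by move=> s t u _ IH _ IH' p; rewrite IH.
- by move=> s s' t t' _ IH _ IH' p; rewrite IH IH'.
- by move=> s s' t t' _ IH _ IH' p; rewrite IH' IH.
- by move=> s t u p /=; rewrite addrA.
- by move=> s t p /=; rewrite addrC.
- by move=> s p /=; rewrite scale0r add0r.
- by move=> s p /=; rewrite scale1r.
- by move=> s p /=; rewrite !scale0r.
- by move=> s t u p /=; rewrite actD.
- by move=> a b p /=; rewrite scalerDl.
- by move=> a b p /=; rewrite scalerA.
- by move=> a s p /=; rewrite actZ.
Qed.

Fact weyl_oner_neq0 : (1 : weyl) != 0.
Proof.
apply/eqP => /presented_eqP/weyl_act_eq/(_ 1) /=; rewrite scale1r scale0r.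
by move/eqP; rewrite oner_eq0.
Qed.
HB.instance Definition _ := GRing.PzSemiRing_isNonZero.Build weyl weyl_oner_neq0.
HB.instance Definition _ := GRing.LSemiModule_isLSemiAlgebra.Build k weyl
  (@presented_scalerAl _ _ _).
HB.instance Definition _ := GRing.LSemiAlgebra_isSemiAlgebra.Build k weyl
  (@presented_scalerAr _ _ _).

Definition weyl_t : weyl := pgen weyl_rel WeylT.
Definition weyl_d : weyl := pgen weyl_rel WeylD.

Lemma weyl_dt : weyl_d * weyl_t - weyl_t * weyl_d = 1.
Proof.
rewrite [X in X - _](presented_relP WeylDT) /= addrC addKr.
by rewrite /pcst scale1r.
Qed.

(* The polynomial f(t) as an element of the Weyl algebra. *)
Definition weyl_poly (f : {poly k}) : weyl := horner_alg weyl_t f.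
HB.instance Definition _ := GRing.RMorphism.copy weyl_poly (horner_alg weyl_t).

Fact weyl_poly_scalable : scalable weyl_poly.
Proof.
move=> a p; rewrite -mul_polyC rmorphM /= {1}/weyl_poly horner_algC.
by rewrite -scalerAl mul1r.
Qed.
HB.instance Definition _ :=
  GRing.isScalable.Build k {poly k} weyl *:%R weyl_poly weyl_poly_scalable.

Lemma weyl_poly_linear (a : k) (p q : {poly k}) :
  weyl_poly (a *: p + q) = a *: weyl_poly p + weyl_poly q.
Proof. by rewrite rmorphD /= linearZ. Qed.

Lemma weyl_d_poly f :
  weyl_d * weyl_poly f = weyl_poly f * weyl_d + weyl_poly f^`().
Proof.
elim/poly_ind: f => [|f c IH]; first by rewrite deriv0 !rmorph0 mulr0 mul0r addr0.
have polyX : weyl_poly 'X = weyl_t by rewrite /weyl_poly horner_algX.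
have dt : weyl_d * weyl_t = weyl_t * weyl_d + 1.
  by rewrite -weyl_dt addrC subrK.
have polyC : weyl_poly c%:P = c *: 1 by rewrite /weyl_poly horner_algC.
rewrite derivMXaddC !rmorphD !rmorphM /= polyX polyC mulrDr mulrA IH mulrDl.
rewrite -(mulrA _ weyl_d) dt mulrDr mulr1 mulrA !mulrDl.
rewrite -[c *: 1 * weyl_d]scalerAl mul1r -[weyl_d * _]scalerAr mulr1.
by rewrite -!addrA; congr (_ + _); rewrite [RHS]addrC addrA.
Qed.

End Weyl.

(* [f : witt k] stands for the vector field f(t)d/dt. *)
Definition witt (k : fieldType) : Type := {poly k}.

Section Witt.
Variable k : fieldType.
HB.instance Definition _ := GRing.Lmodule.on (witt k).

Definition witt_lie (f g : {poly k}) : {poly k} := f * g^`() - f^`() * g.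

Fact witt_lie_linearl g : linear (witt_lie^~ g).
Proof.
move=> a f h; rewrite /witt_lie derivD derivZ scalerBr -!mul_polyC; ring.
Qed.
Fact witt_lie_linearr f : linear (witt_lie f).
Proof.
move=> a g h; rewrite /witt_lie derivD derivZ scalerBr -!mul_polyC; ring.
Qed.
Fact witt_liexx f : witt_lie f f = 0.
Proof. by rewrite /witt_lie mulrC subrr. Qed.
Fact witt_lie_jacobi f g h : witt_lie f (witt_lie g h)
  + witt_lie g (witt_lie h f) + witt_lie h (witt_lie f g) = 0.
Proof. by rewrite /witt_lie !(derivB, derivM); ring. Qed.
HB.instance Definition _ := Lmodule_isLieAlgebra.Build k (witt k)
  witt_lie_linearl witt_lie_linearr witt_liexx witt_lie_jacobi.

(* witt_e i = t^(i+1) d/dt, meaningful for i >= -1. *)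
Definition witt_e (i : int) : witt k := 'X^(absz (i + 1)).

(* The span of the witt_e i for i >= n; see witt_geP for coefficients. *)
Definition witt_ge (n : nat) : {pred witt k} := fun f =>
  `[< exists (N : nat) (c : nat -> k),
        f = \sum_(i < N) c i *: witt_e (n%:Z + i%:Z) >].

Lemma witt_e_nat (i : nat) : witt_e i%:Z = 'X^(i.+1).
Proof. by rewrite /witt_e -PoszD absz_nat addn1. Qed.

Lemma witt_geP n (f : {poly k}) :
  reflect (forall j, (j <= n)%N -> f`_j = 0) (f \in witt_ge n).
Proof.
apply: (iffP (asboolP _)) => [[N [c ->]] j jn|f0].
  have -> : (\sum_(i < N) c i *: witt_e (n%:Z + i%:Z) : witt k)
            = \sum_(i < N) c i *: ('X^((n + i).+1) : {poly k}).
    by apply: eq_bigr => i _; rewrite -PoszD witt_e_nat.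
  rewrite coef_sum big1 // => i _; rewrite coefZ coefXn.
  by rewrite ltn_eqF ?mulr0 // ltnS (leq_trans jn) ?leq_addr.
exists (size f), (fun i => f`_(n + i).+1).
have -> : (\sum_(i < size f) f`_(n + i).+1 *: witt_e (n%:Z + i%:Z) : witt k)
          = \sum_(i < size f) f`_(n + i).+1 *: ('X^((n + i).+1) : {poly k}).
  by apply: eq_bigr => i _; rewrite -PoszD witt_e_nat.
apply/polyP => j; rewrite coef_sum; have [jn|nj] := leqP j n.
  rewrite f0 // big1 // => i _; rewrite coefZ coefXn.
  by rewrite ltn_eqF ?mulr0 // ltnS (leq_trans jn) ?leq_addr.
have [jf|fj] := ltnP j (size f); last first.
  rewrite nth_default // big1 // => i _; rewrite coefZ coefXn.
  by case: eqP => [<-|]; rewrite ?mulr0 // nth_default ?mul0r.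
have lt : (j - n.+1 < size f)%N by rewrite (leq_ltn_trans (leq_subr _ _)).
rewrite (bigD1 (Ordinal lt)) //= big1 ?addr0 => [|i ij].
  by rewrite coefZ coefXn -addSn subnKC // eqxx mulr1.
rewrite coefZ coefXn; case: eqP => [jE|]; last by rewrite mulr0.
by case/eqP: ij; apply/val_inj; rewrite /= jE -addSn addKn.
Qed.

Fact witt_ge_submod n : submod_closed (witt_ge n).
Proof.
split; first by apply/witt_geP => j _; rewrite coef0.
move=> a f g /witt_geP f0 /witt_geP g0.
have : (a *: (f : {poly k}) + (g : {poly k})) \in witt_ge n; last by [].
by apply/witt_geP => j jn; rewrite coefD coefZ f0 ?g0 ?mulr0 ?addr0.
Qed.
HB.instance Definition _ n := GRing.isSubmodClosed.Build k (witt k) (witt_ge n)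
  (GRing.submod_closed_semi (witt_ge_submod n)).

Lemma witt_ge_lie n (f g : witt k) :
  f \in witt_ge 0 -> g \in witt_ge n -> lie f g \in witt_ge n.
Proof.
move=> /witt_geP f0 /witt_geP g0; apply/witt_geP => j jn.
rewrite coefB !coefM !big1 ?subr0 // => i _.
  by rewrite g0 ?mulr0 // (leq_trans (leq_subr _ _)).
case: i => -[|i] ij /=; first by rewrite f0 ?mul0r.
by rewrite coef_deriv g0 ?mul0rn ?mulr0 // -subSn // subSS (leq_trans (leq_subr _ _)).
Qed.

Record witt0 := Witt0 { witt0_val :> witt k; witt0P : witt0_val \in witt_ge 0 }.

HB.instance Definition _ := [isSub for witt0_val].
HB.instance Definition _ := [Choice of witt0 by <:].
HB.instance Definition _ := [SubChoice_isSubLmodule of witt0 by <:].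

Definition witt0_lie (x y : witt0) : witt0 :=
  Witt0 (witt_ge_lie (witt0P x) (witt0P y)).

Fact witt0_linearl y : linear (witt0_lie^~ y).
Proof. by move=> a x z; apply: val_inj; rewrite /= lie_linearl. Qed.
Fact witt0_linearr x : linear (witt0_lie x).
Proof. by move=> a y z; apply: val_inj; rewrite /= lie_linearr. Qed.
Fact witt0_liexx x : witt0_lie x x = 0.
Proof. by apply: val_inj; rewrite /= liexx. Qed.
Fact witt0_jacobi x y z : witt0_lie x (witt0_lie y z)
  + witt0_lie y (witt0_lie z x) + witt0_lie z (witt0_lie x y) = 0.
Proof. by apply: val_inj; rewrite /= lie_jacobi. Qed.
HB.instance Definition _ := Lmodule_isLieAlgebra.Build k witt0
  witt0_linearl witt0_linearr witt0_liexx witt0_jacobi.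

Section Quotient.
Variable n : nat.

Definition witt_gwitt_e_in_witt0 : {pred witt0} := fun x => witt0_val x \in witt_ge n.

Fact witt_gwitt_e_in_witt0_submod : submod_closed witt_gwitt_e_in_witt0.
Proof.
split; first exact: (rpred0 (witt_ge n)).
move=> a x y xn yn.
change (a *: witt0_val x + witt0_val y \in witt_ge n).
by apply: rpredD; [apply: rpredZ|].
Qed.
Fact witt_gwitt_e_in_witt0_lie (x y : witt0) :
  y \in witt_gwitt_e_in_witt0 -> lie x y \in witt_gwitt_e_in_witt0.
Proof. exact: witt_ge_lie (witt0P x). Qed.

Definition witt_ge_ideal : lieIdeal witt0 :=
  LieIdeal witt_gwitt_e_in_witt0_submod witt_gwitt_e_in_witt0_lie.

(* The Lie algebra g_n, W_{>= 0} modulo W_{>= n}, with basis the classes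
   gquot_v i of witt_e i for i < n. *)
Definition gquot : Type := lie_quot witt_ge_ideal.
HB.instance Definition _ := LieAlgebra.on gquot.

Fact witt_e_in_witt0 (i : nat) : witt_e i%:Z \in witt_ge 0.
Proof.
by rewrite witt_e_nat; apply/witt_geP => j; rewrite leqn0 coefXn => /eqP ->.
Qed.

Definition gquot_v (i : nat) : gquot := lieq witt_ge_ideal (Witt0 (witt_e_in_witt0 i)).

Lemma gquot_v_ge i : (n <= i)%N -> gquot_v i = 0.
Proof.
move=> ni; have -> : 0 = lieq witt_ge_ideal 0 by rewrite linear0.
apply/lieq_eqP; rewrite subr0; change (witt_e i%:Z \in witt_ge n).
rewrite witt_e_nat; apply/witt_geP => j jn.
by rewrite coefXn ltn_eqF // ltnS (leq_trans jn).
Qed.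

Lemma gquot_v_lie i j : lie (gquot_v i) (gquot_v j) = (j%:R - i%:R) *: gquot_v (i + j).
Proof.
rewrite [LHS]/= -[LHS]lieq_lieE -[RHS]linearZ; congr lieq.
apply: val_inj; change (witt_lie (witt_e i%:Z) (witt_e j%:Z) =
  (j%:R - i%:R) *: (witt_e (i + j)%:Z : {poly k})).
rewrite !witt_e_nat /witt_lie !derivXn /= mulrnAr mulrnAl -!exprD addSn addnS.
by rewrite scalerBl !scaler_nat !mulrS opprD addrACA subrr add0r.
Qed.

End Quotient.
End Witt.

Section DividedDerivatives.
Variable k : fieldType.
Implicit Types p q : {poly k}.

Lemma deriv_nderivn p n : (p^`N(n))^`() = p^`N(n.+1) *+ n.+1.
Proof.
apply/polyP => i; rewrite coef_deriv coefMn !coef_nderivn addnS addSn.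
rewrite -!mulrnA; congr (_ *+ _).
by rewrite mulnC [in RHS]mulnC mul_bin_left subSn ?leq_addr // addKn mulnC.
Qed.

Lemma nderivn_deriv p n : (p^`())^`N(n) = p^`N(n.+1) *+ n.+1.
Proof.
apply/polyP => i; rewrite coefMn !coef_nderivn coef_deriv addSn.
by rewrite -!mulrnA; congr (_ *+ _); rewrite mul_bin_diag mulnC.
Qed.

Lemma nderivnM p q n :
  (p * q)^`N(n) = \sum_(i < n.+1) p^`N(i) * q^`N(n - i).
Proof.
elim/poly_ind: p n => [|p c IH] n.
  by rewrite mul0r linear0 big1 // => i _; rewrite linear0 mul0r.
have -> : (p * 'X + c%:P) * q = (p * q) * 'X + (c *: q).
  by rewrite mulrDl mul_polyC mulrAC.
rewrite linearD /= linearZ /=; case: n => [|n].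
  by rewrite big_ord1 subn0 !nderivn0 mulrDl mul_polyC mulrAC.
have nX u m : (u * 'X)^`N(m.+1) = u^`N(m) + u^`N(m.+1) * 'X.
  by rewrite -[u * 'X]addr0 -polyC0 nderivnMXaddC.
rewrite nX !IH [RHS]big_ord_recl nderivn0 subn0.
under [in RHS]eq_bigr => i _.
  rewrite lift0 nderivnMXaddC subSS mulrDl.
  over.
rewrite big_split /= [X in _ + X * 'X]big_ord_recl nderivn0 subn0.
rewrite [in RHS]mulrDl mul_polyC [in LHS]mulrDl.
have -> : (\sum_(i < n.+1) p^`N(lift ord0 i) * q^`N(n.+1 - lift ord0 i)) * 'X =
  \sum_(i < n.+1) p^`N(i.+1) * 'X * q^`N(n - i).
  by rewrite mulr_suml; apply: eq_bigr => i _; rewrite lift0 subSS mulrAC.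
by rewrite [p * 'X * _]mulrAC; ring.
Qed.

Lemma nderivn_witt_lie (f g : {poly k}) (m : nat) :
  (witt_lie f g)^`N(m.+1) =
    f * (g^`N(m.+1))^`() - g * (f^`N(m.+1))^`()
    + \sum_(i < m.+1)
        (((m - i)%:R - i%:R : k) *: (f^`N(i.+1) * g^`N((m - i).+1))).
Proof.
rewrite /witt_lie linearB /= !nderivnM [X in X - _]big_ord_recl.
rewrite [X in _ - X]big_ord_recr /= nderivn0 subn0 subnn nderivn0.
rewrite !nderivn_deriv !deriv_nderivn (mulrC g) opprD.
rewrite [X in _ + _ + X = _]addrC addrACA; congr (_ + _).
rewrite -sumrB; apply: eq_bigr => i _; have im : (i <= m)%N by rewrite -ltnS.
rewrite /bump add1n subSS !nderivn_deriv subSn // mulrnAr mulrnAl.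
by rewrite scalerBl !scaler_nat !mulrS opprD addrACA subrr add0r.
Qed.

End DividedDerivatives.

Lemma sum_triangle (V : zmodType) (n : nat) (F : nat -> nat -> V) :
    (forall i j, (n <= i + j)%N -> F i j = 0) ->
  \sum_(i < n) \sum_(j < n) F i j = \sum_(m < n) \sum_(i < m.+1) F i (m - i)%N.
Proof.
move=> F0.
have -> : \sum_(m < n) \sum_(i < m.+1) F i (m - i)%N =
          \sum_(m < n) \sum_(i < n | (i <= m)%N) F i (m - i)%N.
  apply: eq_bigr => m _; rewrite (big_ord_widen_cond n predT (fun i => F i (m - i)%N)) //.
rewrite [RHS](exchange_big_dep predT) //=; apply: eq_bigr => i _.
rewrite -[LHS](big_mkord xpredT (fun j => F i j)) -[RHS](big_mkord (fun m => (i <= m)%N) (fun m => F i (m - i)%N)).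
have ni : (n - i <= n)%N by rewrite leq_subr.
rewrite (big_cat_nat (n := n - i)) //= [X in _ + X]big_nat [X in _ + X]big1.
  rewrite addr0; have iN : (i <= n)%N by rewrite ltnW.
  rewrite [RHS](big_cat_nat (n := i)) //= [X in _ = X + _]big_nat_cond.
  rewrite [X in _ = X + _]big1 ?add0r.
    rewrite [RHS](big_addn 0 n i).
    rewrite big_nat_cond [RHS]big_nat_cond; apply: congr_big => //.
      by move=> j; rewrite leq_addl !andbT.
    by move=> j _; rewrite addnK.
  by move=> j /andP[/andP[_ ji] ij]; rewrite leqNgt ji in ij.
by move=> j /andP[nj _]; rewrite F0 // -leq_subLR.
Qed.

Section Orbit.
Variables (k : fieldType) (n : nat).

(* The algebra T_n = A_1 (x) U(g_n). *)
Definition orbit_alg : Type := tens_alg (weyl k) (env (gquot k n)).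
HB.instance Definition _ := GRing.PzRing.on orbit_alg.
HB.instance Definition _ := GRing.Lmodule.on orbit_alg.

Fact zero_gquot_lie (x y : gquot k n) :
  (\0 (lie x y) : weyl k) = \0 x * \0 y - \0 y * \0 x.
Proof. by rewrite /= mulr0 subrr. Qed.

Definition env_aug : env (gquot k n) -> weyl k := env_lift zero_gquot_lie.
HB.instance Definition _ := GRing.LRMorphism.on env_aug.

Fact env_aug_comm a b : idfun a * env_aug b = env_aug b * idfun a.
Proof.
have [c ->] : exists c : k, env_aug b = c *: 1; last first.
  by rewrite /= -scalerAr -scalerAl mulr1 mul1r.
move: b; apply: presented_ind => [x|c|x y [c xE] [d yE]|x y [c xE] [d yE]].
- by exists 0; rewrite scale0r; apply: (env_liftE zero_gquot_lie).
- by exists c; apply: (rmorph_alg env_aug c).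
- by exists (c + d); rewrite scalerDl;
  apply: (etrans (raddfD env_aug x y) (f_equal2 +%R xE yE)).
- exists (c * d); apply: (etrans (rmorphM env_aug x y) (etrans (f_equal2 *%R xE yE) _)).
  by rewrite -scalerAl mul1r scalerA.
Qed.

Fact orbit_alg_oner_neq0 : (1 : orbit_alg) != 0.
Proof. exact: plift_oner_neq0 (tens_respects env_aug_comm). Qed.
HB.instance Definition _ :=
  GRing.PzSemiRing_isNonZero.Build orbit_alg orbit_alg_oner_neq0.
HB.instance Definition _ := GRing.LSemiModule_isLSemiAlgebra.Build k orbit_alg
  (@presented_scalerAl _ _ _).
HB.instance Definition _ := GRing.LSemiAlgebra_isSemiAlgebra.Build k orbit_alg
  (@presented_scalerAr _ _ _).

(* [f^`N(i.+1)] is the (i+1)-st derivative of f divided by (i+1)!, so this is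
   the image of f(t)d/dt, see [PsiE] below. *)
Definition psi (f : witt k) : orbit_alg :=
  tens (weyl_poly f * weyl_d k) 1
  + \sum_(i < n) tens (weyl_poly f^`N(i.+1)) (env_gen (gquot_v k n i)).

Fact psi_is_linear : linear psi.
Proof.
move=> a f h; rewrite /psi scalerDr scaler_sumr addrACA -big_split /=.
congr (_ + _).
  rewrite -tensZl -tensDl scalerAl -mulrDl.
  by congr (tens (_ * _) _); apply: weyl_poly_linear.
apply: eq_bigr => i _; rewrite -tensZl -tensDl; congr (tens _ _).
rewrite -weyl_poly_linear; congr weyl_poly.
exact: (linearP (@nderivn k i.+1) a (f : {poly k}) (h : {poly k})).
Qed.
HB.instance Definition _ := GRing.isLinear.Build k (witt k) orbit_alg _ psi psi_is_linear.

Local Notation P f := (tens (weyl_poly f) (1 : env (gquot k n)) : orbit_alg).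
Local Notation D := (tens (weyl_d k) (1 : env (gquot k n)) : orbit_alg).
Local Notation V i := (tens (1 : weyl k) (env_gen (gquot_v k n i)) : orbit_alg).

Lemma psiE f : psi f = P f * D + \sum_(i < n) P (f^`N(i.+1)) * V i.
Proof.
rewrite /psi; congr (_ + _); first by rewrite [RHS]tensM mulr1.
by apply: eq_bigr => i _; rewrite [RHS]tensM mulr1 mul1r.
Qed.

Fact psi_lie (f h : witt k) : psi (lie f h) = psi f * psi h - psi h * psi f.
Proof.
have PM p q : P (p * q) = P p * P q by rewrite [RHS]tensM -rmorphM mulr1.
have PD p q : P (p + q) = P p + P q by rewrite -[RHS]tensDl -rmorphD.
have PZ a p : P (a *: p) = a *: P p by rewrite -[RHS]tensZl -linearZ.
have PN p : P (- p) = - P p by rewrite -scaleN1r PZ scaleN1r.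
have DP p : D * P p = P p * D + P p^`().
  by rewrite [LHS]tensM weyl_d_poly tensDl mulr1 [X in _ = X + _]tensM mulr1.
have VP i p : V i * P p = P p * V i by rewrite [LHS]tensM [RHS]tensM !mulr1 !mul1r.
have VD i : V i * D = D * V i by rewrite [LHS]tensM [RHS]tensM !mulr1 !mul1r.
have VV i j : V i * V j - V j * V i = (j%:R - i%:R) *: V (i + j)%N.
  rewrite [X in X - _]tensM [X in _ - X]tensM mulr1.
  rewrite -tensZr -linearZ /= -gquot_v_lie env_gen_lie.
  by rewrite -scaleN1r -tensZr -tensDr scaleN1r.
have V0 m : (n <= m)%N -> V m = 0.
  by move=> nm; rewrite gquot_v_ge // linear0 -(scale0r 0) tensZr scale0r.
have DD p q : P p * D * (P q * D) = P (p * q) * D * D + P (p * q^`()) * D.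
  by rewrite !mulrA -(mulrA (P p)) DP mulrDr mulrDl !mulrA -!PM.
have DV p q i : P p * D * (P q * V i) - P q * V i * (P p * D)
                = P (p * q^`()) * V i.
  rewrite !mulrA -(mulrA (P p)) DP mulrDr mulrDl -(mulrA (P q)) VP !mulrA -!PM.
  by rewrite -[X in _ - X]mulrA VD !mulrA (mulrC q) addrC addKr.
have VV' p q i j : P p * V i * (P q * V j) - P q * V j * (P p * V i)
                   = P ((j%:R - i%:R) *: (p * q)) * V (i + j)%N.
  rewrite !mulrA -(mulrA (P p)) -(mulrA (P q)) !VP !mulrA -!PM (mulrC q).
  by rewrite -!mulrA -mulrBr VV PZ -presented_scalerAl -presented_scalerAr.
pose S p : orbit_alg := \sum_(i < n) P (p^`N(i.+1)) * V i.
have DS p q : P p * D * S q - S q * (P p * D)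
              = \sum_(i < n) P (p * (q^`N(i.+1))^`()) * V i.
  rewrite mulr_sumr mulr_suml -sumrB; apply: eq_bigr => i _; exact: DV.
have SS : S f * S h - S h * S f = \sum_(m < n) \sum_(i < m.+1)
    P (((m - i)%:R - i%:R) *: (f^`N(i.+1) * h^`N((m - i).+1))) * V m.
  pose F i j := P ((j%:R - i%:R) *: (f^`N(i.+1) * h^`N(j.+1))) * V (i + j)%N.
  transitivity (\sum_(i < n) \sum_(j < n) F i j).
    rewrite mulr_suml [S h * _]mulr_sumr -sumrB; apply: eq_bigr => i _.
    by rewrite mulr_sumr mulr_suml -sumrB; apply: eq_bigr => j _; apply: VV'.
  rewrite sum_triangle => [|i j ij]; last by rewrite /F V0 ?mulr0.
  apply: eq_bigr => m _; apply: eq_bigr => i _.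
  by rewrite /F subnKC // -ltnS.
rewrite !psiE -/(S f) -/(S h) !(mulrDl, mulrDr).
have -> : \sum_(i < n) P ((lie f h : {poly k})^`N(i.+1)) * V i =
    (P f * D * S h - S h * (P f * D)) - (P h * D * S f - S f * (P h * D))
    + (S f * S h - S h * S f).
  rewrite SS !DS -sumrB -big_split /=; apply: eq_bigr => i _.
  rewrite -mulr_suml -mulrBl -mulrDl; congr (_ * _).
  rewrite [lie f h]/(witt_lie f h) nderivn_witt_lie !PD PN; congr (_ + _).
  by rewrite (big_morph (fun p => P p) PD (id1 := 0)) // -(scale0r 0) PZ scale0r.
have -> : P (lie f h : {poly k}) * D = P f * D * (P h * D) - P h * D * (P f * D).
  rewrite !DD [lie f h]/(witt_lie f h) /witt_lie PD PN mulrDl mulNr (mulrC h).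
  by rewrite [h * _]mulrC opprD addrACA subrr add0r.
rewrite !(opprD, opprK, addrA).
by rewrite [LHS](GRing.add.[ACl 1*3*6*7*2*5*4*8]).
Qed.

Definition Psi : env (witt k) -> orbit_alg := env_lift psi_lie.
HB.instance Definition _ := GRing.LRMorphism.on Psi.

Lemma PsiE (f : {poly k}) : [pchar k] =i pred0 ->
  Psi (env_gen (f : witt k)) = tens (weyl_poly f * weyl_d k) 1
  + \sum_(i < n)
      tens (weyl_poly ((i.+1)`!%:R^-1 *: f^`(i.+1))) (env_gen (gquot_v k n i)).
Proof.
move=> char0; rewrite [LHS]env_liftE; congr (_ + _); apply: eq_bigr => i _.
congr (tens (weyl_poly _) _); rewrite nderivn_def -scaler_nat scalerA.
by rewrite mulVf ?scale1r // ((pcharf0P k).1 char0) -lt0n fact_gt0.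
Qed.

End Orbit.
Arguments psi k n f : clear implicits.
Arguments Psi k n x : clear implicits.

Section Ideals.
Variable R : pzRingType.

Definition left_ideal (I : set R) : Prop :=
  [/\ I 0, forall x y, I x -> I y -> I (x + y) & forall a x, I x -> I (a * x)].

Definition two_sided_ideal (I : set R) : Prop :=
  left_ideal I /\ forall x a, I x -> I (x * a).

Definition left_ideal_gen (S : set R) : set R :=
  [set x | forall I, left_ideal I -> S `<=` I -> I x].

Definition two_sided_ideal_gen (S : set R) : set R :=
  [set x | forall I, two_sided_ideal I -> S `<=` I -> I x].

End Ideals.

Definition ker_set (R S : pzRingType) (f : R -> S) : set R := f @^-1` [set 0].

Definition differentiator (k : fieldType) (m : nat) (r s : int) : env (witt k) :=
  \sum_(i < m.+1) ((-1) ^+ i *+ 'C(m, i))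
    * (env_gen (witt_e k (r - i%:Z)) * env_gen (witt_e k (s + i%:Z))).

(* Main.v *)
Require Import Defs.
From HB Require Import structures.
From mathcomp Require Import all_boot all_order all_algebra.
From mathcomp Require Import boolp classical_sets.
From mathcomp Require Import mpoly.
From mathcomp Require Import ring zify.

Set Implicit Arguments.
Unset Strict Implicit.
Unset Printing Implicit Defensive.

Import Order.TTheory GRing.Theory Num.Theory.
Local Open Scope ring_scope.

(** Write [L] for the left ideal generated by the differentiators of order [m]
   and [e_f] for the generator [f d/dt].

   The differentiators lie in the kernel ([differentiator_orbit]): the
   coefficients of [Psi e_f * Psi e_g] are products of an [l]-th and an [l']-th
   divided derivative of [f] and [g] with [l + l' <= 2n], and an [m]-th finite
   difference of exponents kills all of them as soon as [m > 2n].

   The kernel lies in [L] ([kernel_in_ideal], valid for every left ideal that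
   contains the differentiators and lies in the kernel, hence also for the
   two-sided ideal generated by one of them once it contains all of them).  Put [x_i] for the
   product of the generators [t^(N - i) d/dt] and [t^i d/dt].  Modulo [L] the
   sequence [x_i] has vanishing [m]-th differences, so it is polynomial in [i]
   of degree less than [2n + 2] and Lagrange interpolation expresses every
   [x_i] through the [2n + 2] outermost ones ([swap_large]); these contain a
   letter [t^j d/dt] with [j <= n].  Hence, modulo [L] and shorter products,
   every element is a combination of ordered monomials in the letters
   [j <= n], followed by one arbitrary letter ([reducible_filtered]).  To see
   that no combination of these normal forms is killed by [Psi], the
   target of [Psi] is made to act on a polynomial ring: [A_1] acts on functions
   of [t], and the Lie algebra of jets acts through Lie derivatives on
   truncated 1-forms.  Conjugating by the exponential of [lambda] times a
   linear form turns the coefficient of the highest power of [lambda] into a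
   multiplicative symbol ([top_symbol_field_word]).  At a suitable point, and
   for a suitable linear form, the symbol of the letter [j] is a variable for
   [j <= n] and, for [j > n], a polynomial of degree exactly [j] in [t]
   ([letter_symbol_small], [coef_letter_symbol]).  Comparing degrees in [t]
   shows that the normal form of an element of the kernel has no letter
   beyond [n], and then that it vanishes up to shorter products
   ([kernel_filtered]).

   Every nonzero differentiator generates all of them as a two-sided ideal
   ([quad_in_lowest_vector], [quad_in_multiples]).  Record the product of
   [a d/dt] and [b d/dt] by the polynomial [a(t1) b(t2)]; the differentiators
   are then the products of [(t1 - t2)^m] and monomials.  Put [u = t1 + t2] and [v = t1 - t2].  A
   two-sided ideal is stable under commutators, which act by explicit
   differential operators: [d/dt] lowers the degree in [u], so that the ideal
   contains [v^(2n + 2)]; then [t^2 d/dt] and [t^3 d/dt] raise degrees and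
   produce every [u^i v^j] with [j >= 2n + 2] even.  The odd powers of [v] cost
   nothing, because the polynomials that are antisymmetric and divisible by
   [v^2] represent [0]. *)

(** * Semilinear operators on a commutative ring *)
Section Endomorphisms.
Variables (k : fieldType) (R : comNzRingType) (io : {rmorphism k -> R}).

Definition semilinear_op (f : R -> R) : Prop :=
  forall a p q, f (io a * p + q) = io a * f p + f q.

(** Additive maps that commute with the image of [k].  The operators used below
   act on rings of the form [{poly R}] whose own scalars are much bigger than
   [k], hence the explicit structure map [io]. *)
Record endo := Endo { endo_fun :> R -> R; endoP : semilinear_op endo_fun }.

HB.instance Definition _ := gen_eqMixin endo.
HB.instance Definition _ := gen_choiceMixin endo.

Lemma endo_ext (f g : endo) : f =1 g -> f = g.
Proof.
case: f g => [f fP] [g gP] /= fg; have {}fg : f = g by apply/funext.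
by rewrite fg in fP *; congr Endo; apply: Prop_irrelevance.
Qed.

Lemma endoD (f : endo) p q : f (p + q) = f p + f q.
Proof. by have := endoP f 1 p q; rewrite rmorph1 !mul1r. Qed.
Lemma endo0 (f : endo) : f 0 = 0.
Proof. by apply: (addrI (f 0)); rewrite -endoD !addr0. Qed.
Lemma endoZ (f : endo) a p : f (io a * p) = io a * f p.
Proof. by rewrite -[io a * p]addr0 endoP endo0 addr0. Qed.

Fact endo_add_subproof (f g : endo) : semilinear_op (fun p => f p + g p).
Proof. by move=> a p q; rewrite !endoP mulrDr addrACA. Qed.
Fact endo_zero_subproof : semilinear_op (fun=> 0).
Proof. by move=> a p q; rewrite mulr0 addr0. Qed.
Fact endo_opp_subproof (f : endo) : semilinear_op (fun p => - f p).
Proof. by move=> a p q; rewrite endoP opprD mulrN. Qed.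
Fact endo_comp_subproof (f g : endo) : semilinear_op (fun p => f (g p)).
Proof. by move=> a p q; rewrite !endoP. Qed.
Fact endo_one_subproof : semilinear_op (fun p => p).
Proof. by []. Qed.
Fact endo_scale_subproof a (f : endo) : semilinear_op (fun p => io a * f p).
Proof. by move=> b p q; rewrite endoP mulrDr mulrCA. Qed.

Definition endo_add f g := Endo (endo_add_subproof f g).
Definition endo_zero := Endo endo_zero_subproof.
Definition endo_opp f := Endo (endo_opp_subproof f).
Definition endo_comp f g := Endo (endo_comp_subproof f g).
Definition endo_one := Endo endo_one_subproof.
Definition endo_scale a f := Endo (endo_scale_subproof a f).

Fact endo_addA : associative endo_add.
Proof. by move=> f g h; apply: endo_ext => p; apply: addrA. Qed.
Fact endo_addC : commutative endo_add.
Proof. by move=> f g; apply: endo_ext => p; apply: addrC. Qed.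
Fact endo_add0 : left_id endo_zero endo_add.
Proof. by move=> f; apply: endo_ext => p; apply: add0r. Qed.
Fact endo_addN : left_inverse endo_zero endo_opp endo_add.
Proof. by move=> f; apply: endo_ext => p; apply: addNr. Qed.
HB.instance Definition _ :=
  GRing.isZmodule.Build endo endo_addA endo_addC endo_add0 endo_addN.

Fact endo_compA : associative endo_comp.
Proof. by move=> f g h; apply: endo_ext. Qed.
Fact endo_comp1 : left_id endo_one endo_comp.
Proof. by move=> f; apply: endo_ext. Qed.
Fact endo_comp1r : right_id endo_one endo_comp.
Proof. by move=> f; apply: endo_ext. Qed.
Fact endo_compDl : left_distributive endo_comp endo_add.
Proof. by move=> f g h; apply: endo_ext. Qed.
Fact endo_compDr : right_distributive endo_comp endo_add.
Proof. by move=> f g h; apply: endo_ext => p; apply: endoD. Qed.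
HB.instance Definition _ := GRing.Zmodule_isPzRing.Build endo
  endo_compA endo_comp1 endo_comp1r endo_compDl endo_compDr.

Fact endo_oner_neq0 : (1 : endo) != 0.
Proof.
apply/eqP => /(congr1 (fun f : endo => f 1)) /= /eqP.
by rewrite (negPf (oner_neq0 R)).
Qed.
HB.instance Definition _ := GRing.PzSemiRing_isNonZero.Build endo endo_oner_neq0.

Fact endo_scaleA a b f : endo_scale a (endo_scale b f) = endo_scale (a * b) f.
Proof. by apply: endo_ext => p; rewrite /= rmorphM mulrA. Qed.
Fact endo_scale1 : left_id 1 endo_scale.
Proof. by move=> f; apply: endo_ext => p; rewrite /= rmorph1 mul1r. Qed.
Fact endo_scaleDr : right_distributive endo_scale endo_add.
Proof. by move=> a f g; apply: endo_ext => p; apply: mulrDr. Qed.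
Fact endo_scaleDl f : {morph endo_scale^~ f : a b / a + b >-> endo_add a b}.
Proof. by move=> a b; apply: endo_ext => p; rewrite /= rmorphD mulrDl. Qed.
HB.instance Definition _ := GRing.Zmodule_isLmodule.Build k endo
  endo_scaleA endo_scale1 endo_scaleDr endo_scaleDl.

Fact endo_scalerAl a (f g : endo) : a *: (f * g) = (a *: f) * g.
Proof. exact: endo_ext. Qed.
Fact endo_scalerAr a (f g : endo) : a *: (f * g) = f * (a *: g).
Proof. by apply: endo_ext => p; rewrite /= endoZ. Qed.
HB.instance Definition _ :=
  GRing.LSemiModule_isLSemiAlgebra.Build k endo endo_scalerAl.
HB.instance Definition _ :=
  GRing.LSemiAlgebra_isSemiAlgebra.Build k endo endo_scalerAr.

Fact endo_mul_subproof (r : R) : semilinear_op ( *%R r).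
Proof. by move=> a p q; rewrite mulrDr mulrCA. Qed.
Definition endo_mul r : endo := Endo (endo_mul_subproof r).

End Endomorphisms.

(** * Polynomial vector fields and their twists *)
Section Derivations.
Variables (n : nat) (K : comNzRingType).
Local Notation R0 := {mpoly K[n]}.
Implicit Types (c : 'I_n -> R0) (p q : R0) (P Q : {poly R0}).

Definition der c p : R0 := \sum_l c l * mderiv l p.

Fact der_is_zmod_morphism c : zmod_morphism (der c).
Proof.
by move=> p q; rewrite /der -sumrB; apply: eq_bigr => l _; rewrite raddfB mulrBr.
Qed.
HB.instance Definition _ c := GRing.isZmodMorphism.Build R0 R0 (der c)
  (der_is_zmod_morphism c).

Lemma derM c p q : der c (p * q) = der c p * q + p * der c q.
Proof.
rewrite /der mulr_suml mulr_sumr -big_split /=; apply: eq_bigr => l _.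
rewrite mderivM; ring.
Qed.

Lemma derC c a : der c a%:MP = 0.
Proof. by rewrite /der big1 // => l _; rewrite mderivC mulr0. Qed.

Lemma derX c l : der c 'X_l = c l.
Proof.
rewrite /der (bigD1 l) //= big1 ?addr0 => [|j jl].
  rewrite mderivX mnm1E eqxx.
  have -> : (U_(l) - U_(l) = 0 :> 'X_{1..n})%MM by rewrite -{1}[U_(l)%MM]add0m addmK.
  by rewrite mpolyX0 scale1r mulr1.
by rewrite mderivX mnm1E eq_sym (negPf jl) scale0r mulr0.
Qed.

Definition vf_bracket c1 c2 : 'I_n -> R0 :=
  fun l => der c1 (c2 l) - der c2 (c1 l).

(** The second-order terms of the two compositions agree, since partial
   derivatives commute. *)
Lemma der_bracket c1 c2 p :
  der (vf_bracket c1 c2) p = der c1 (der c2 p) - der c2 (der c1 p).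
Proof.
have derder a b : der a (der b p) = \sum_l der a (b l) * mderiv l p
    + \sum_i \sum_j a i * b j * mderiv i (mderiv j p).
  rewrite {2}/der raddf_sum /=.
  under eq_bigr do rewrite derM.
  rewrite big_split; congr +%R; rewrite exchange_big /=.
  apply: eq_bigr => l _; rewrite /der mulr_sumr; apply: eq_bigr => j _.
  by rewrite mulrCA mulrA.
rewrite !derder [X in _ = _ - (_ + X)]exchange_big /= {1}/der /vf_bracket.
rewrite opprD addrACA -sumrB -[LHS]addr0; congr +%R.
  by apply: eq_bigr => l _; rewrite mulrBl.
symmetry; apply/eqP; rewrite subr_eq0; apply/eqP.
apply: eq_bigr => i _; apply: eq_bigr => j _.
by rewrite mderiv_comm (mulrC (c1 i)).
Qed.

Definition pder c P : {poly R0} := map_poly (der c) P.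

Lemma coef_pder c P i : (pder c P)`_i = der c P`_i.
Proof. by rewrite coef_map_id0 // raddf0. Qed.

Lemma pderD c P Q : pder c (P + Q) = pder c P + pder c Q.
Proof. by apply/polyP => i; rewrite !(coefD, coef_pder) raddfD. Qed.

Lemma pderM c P Q : pder c (P * Q) = pder c P * Q + P * pder c Q.
Proof.
apply/polyP => i; rewrite coefD !coefM coef_pder coefM raddf_sum -big_split /=.
by apply: eq_bigr => j _; rewrite derM !coef_pder.
Qed.

Lemma pderC c p : pder c p%:P = (der c p)%:P.
Proof. exact: map_polyC. Qed.

Lemma pderX c : pder c 'X = 0.
Proof.
apply/polyP => i; rewrite coef_pder coefX coef0.
by case: (i == 1%N); rewrite ?raddf0 // -mpolyC1 derC.
Qed.

Variable phi : R0.

(** The derivation [pder c] conjugated by [exp (lambda phi)], where the formal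
   parameter [lambda] is ['X].  In a product of such operators applied to [1],
   the top power of [lambda] carries the product of the symbols [der c phi]. *)
Definition twist c P : {poly R0} := pder c P + 'X * (der c phi)%:P * P.

(** Conjugation preserves commutators: the terms of degree 2 in [lambda]
   cancel, and those of degree 1 add up to the bracket applied to [phi]. *)
Lemma twist_bracket c1 c2 P :
  twist (vf_bracket c1 c2) P = twist c1 (twist c2 P) - twist c2 (twist c1 P).
Proof.
have tt a b : twist a (twist b P) = pder a (pder b P)
    + 'X * (der a (der b phi))%:P * P
    + ('X * (der b phi)%:P * pder a P + 'X * (der a phi)%:P * pder b P)
    + 'X * 'X * (der a phi)%:P * (der b phi)%:P * P.
  rewrite {1}/twist {1 2}/twist pderD !pderM pderX pderC.
  by ring.
rewrite !tt {1}/twist !der_bracket polyCB.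
have -> : pder (vf_bracket c1 c2) P = pder c1 (pder c2 P) - pder c2 (pder c1 P).
  by apply/polyP => i; rewrite coefB !coef_pder der_bracket.
ring.
Qed.

Lemma twistMl c p P : twist c (p%:P * P) = (der c p)%:P * P + p%:P * twist c P.
Proof. by rewrite /twist pderM pderC; ring. Qed.

Lemma derDl c1 c2 p : der (fun l => c1 l + c2 l) p = der c1 p + der c2 p.
Proof. by rewrite /der -big_split /=; apply: eq_bigr => l _; rewrite mulrDl. Qed.

Lemma derZl q c p : der (fun l => q * c l) p = q * der c p.
Proof. by rewrite /der mulr_sumr; apply: eq_bigr => l _; rewrite mulrA. Qed.

Lemma twistDl c1 c2 P : twist (fun l => c1 l + c2 l) P = twist c1 P + twist c2 P.
Proof.
have e : pder (fun l => c1 l + c2 l) P = pder c1 P + pder c2 P.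
  by apply/polyP => i; rewrite coefD !coef_pder derDl.
by rewrite /twist derDl e polyCD; ring.
Qed.

Lemma twistZl q c P : twist (fun l => q * c l) P = q%:P * twist c P.
Proof.
have e : pder (fun l => q * c l) P = q%:P * pder c P.
  by apply/polyP => i; rewrite coefCM !coef_pder derZl.
by rewrite /twist derZl e polyCM; ring.
Qed.

Lemma twist_ext c1 c2 P : c1 =1 c2 -> twist c1 P = twist c2 P.
Proof. by move=> /funext ->. Qed.

Lemma coef_twist c P i :
  (twist c P)`_i.+1 = der c P`_i.+1 + der c phi * P`_i.
Proof.
by rewrite coefD coef_pder -mulrA [X in _ + X]coefXM /= coefCM.
Qed.

Lemma size_twist c P d : (size P <= d)%N -> (size (twist c P) <= d.+1)%N.
Proof.
move=> Pd; apply/leq_sizeP => -[|i] // di.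
rewrite coef_twist !nth_default ?raddf0 ?mulr0 ?addr0 //.
  exact: leq_trans Pd _.
by rewrite (leq_trans Pd) // ltnW.
Qed.
End Derivations.

(** * Differential operators representing the orbit algebra *)
Section Representation.
Variables (k : fieldType) (n : nat) (K : comNzRingType).
Variables (iota : {rmorphism k -> K}) (zeta : nat -> K).
Local Notation R0 := {mpoly K[n.+1]}.
Implicit Types (p q g h : {poly k}) (P Q : {poly R0}).

Definition scal (a : k) : R0 := (iota a)%:MP.
HB.instance Definition _ := GRing.RMorphism.copy scal (@mpolyC n.+1 K \o iota).
Definition pscal (a : k) : {poly R0} := (scal a)%:P.
HB.instance Definition _ := GRing.RMorphism.copy pscal (polyC \o scal).

Lemma der_scal c a (r : R0) : der c (scal a * r) = scal a * der c r.
Proof. by rewrite derM derC mul0r add0r. Qed.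

(** The variable [0] of [R0] is the coordinate [t], and the variable [j.+1]
   stands for the 1-form [t^j dt], taken modulo [t^n dt]; [vert p] is the form
   [p dt]. *)
Definition vert (p : {poly k}) : R0 :=
  \sum_(j < n) scal p`_j * 'X_(lift ord0 j).

Lemma vertB p q : vert (p - q) = vert p - vert q.
Proof.
rewrite /vert -sumrB; apply: eq_bigr => j _.
by rewrite coefB rmorphB mulrBl.
Qed.

Lemma vertD p q : vert (p + q) = vert p + vert q.
Proof.
rewrite /vert -big_split; apply: eq_bigr => j _.
by rewrite coefD rmorphD mulrDl.
Qed.

Lemma vertZ a p : vert (a *: p) = scal a * vert p.
Proof.
rewrite /vert mulr_sumr; apply: eq_bigr => j _.
by rewrite coefZ rmorphM mulrA.
Qed.

Lemma vert_eq0 p : (forall j, (j < n)%N -> p`_j = 0) -> vert p = 0.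
Proof. by move=> p0; rewrite /vert big1 // => j _; rewrite p0 // rmorph0 mul0r. Qed.

(** The Lie derivative of the 1-form [p dt] along [g d/dt] is [(g p)' dt].
   On 1-forms, unlike on functions, the coefficient with which
   [t^(i + 1) d/dt] maps [t^(n - 1 - i) dt] to [t^(n - 1) dt] is the same
   number [n] for every [i], so that a single rescaling normalizes all
   symbols. *)
Definition lie_field (g : {poly k}) (l : 'I_n.+1) : R0 :=
  if unlift ord0 l is Some j then vert (g * 'X^j)^`() else 0.

Lemma lie_field0 g : lie_field g ord0 = 0.
Proof. by rewrite /lie_field unlift_none. Qed.

Lemma lie_fieldS g j : lie_field g (lift ord0 j) = vert (g * 'X^j)^`().
Proof. by rewrite /lie_field liftK. Qed.

(** A field vanishing at the origin preserves the forms divisible by [t^n], so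
   the truncation is compatible with the action. *)
Lemma der_lie_field_vert (g : {poly k}) p :
  g`_0 = 0 -> der (lie_field g) (vert p) = vert (g * p)^`().
Proof.
move=> g0.
have -> : der (lie_field g) (vert p) = vert (g * take_poly n p)^`().
  rewrite {1}/vert raddf_sum /take_poly poly_def mulr_sumr raddf_sum /=.
  rewrite (big_morph vert vertD (vert_eq0 (p := 0) _)) => [|j _]; last exact: coef0.
  apply: eq_bigr => j _.
  by rewrite der_scal derX lie_fieldS -scalerAr derivZ vertZ.
rewrite -{2}(poly_take_drop n p) mulrDr derivD vertD [X in _ + X]vert_eq0 ?addr0 //.
move=> j jn; rewrite coef_deriv mulrA coefMXn.
case: ifP => [_|/negbT]; first by rewrite mul0rn.
rewrite -leqNgt => nj; have -> : n = j.+1 by apply/eqP; rewrite eqn_leq nj.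
by rewrite subnn coef0M g0 mul0r mul0rn.
Qed.

Lemma lie_field_bracket (g h : {poly k}) : g`_0 = 0 -> h`_0 = 0 ->
  vf_bracket (lie_field g) (lie_field h) =1 lie_field (witt_lie g h).
Proof.
move=> g0 h0 l; rewrite /vf_bracket; case: (unliftP ord0 l) => [j|] ->.
  rewrite !lie_fieldS !der_lie_field_vert // -vertB -derivB; congr (vert _^`()).
  by rewrite /witt_lie !derivM; ring.
by rewrite !lie_field0 !raddf0 addr0.
Qed.

Lemma lie_field_eq0 (g : {poly k}) :
  (forall j, (j <= n)%N -> g`_j = 0) -> lie_field g =1 fun=> 0.
Proof.
move=> g0 l; case: (unliftP ord0 l) => [j|] ->; last exact: lie_field0.
rewrite lie_fieldS vert_eq0 // => i ni; rewrite coef_deriv coefMXn.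
by case: ifP => // _; rewrite ?g0 ?mul0rn // (leq_trans (leq_subr _ _)).
Qed.

(** The linear form whose exponential is used to read off symbols.  The
   coefficients are reversed because [t^(i + 1) d/dt] moves the variable of
   [t^(n - 1 - i) dt] to the one that is nonzero at [base_point]; this makes
   the symbol of [t^(i + 1) d/dt] there equal to [zeta i.+1]. *)
Definition phase : R0 :=
  (zeta 0)%:MP * 'X_ord0 + \sum_(j < n) (zeta (n - j))%:MP * 'X_(lift ord0 j).

Definition twist_fun (c : 'I_n.+1 -> R0) : {poly R0} -> {poly R0} := twist phase c.

Lemma twist_funP c : semilinear_op pscal (twist_fun c).
Proof.
move=> a P Q; rewrite /twist_fun /twist pderD pderM pderC.
have -> : der c (scal a) = 0 by rewrite derC.
by rewrite /pscal /=; ring.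
Qed.

Definition twist_op c : endo pscal := Endo (twist_funP c).

Lemma twist_op_ext c1 c2 : c1 =1 c2 -> twist_op c1 = twist_op c2.
Proof. by move=> e; apply: endo_ext => P; apply: twist_ext. Qed.

Lemma twist_op_bracket c1 c2 : twist_op (vf_bracket c1 c2) =
  twist_op c1 * twist_op c2 - twist_op c2 * twist_op c1.
Proof. by apply: endo_ext => P; apply: twist_bracket. Qed.

Definition base_field (l : 'I_n.+1) : R0 := (l == ord0)%:R.

Definition rep_weyl_gen (w : weyl_gen) : endo pscal :=
  match w with
  | WeylT => endo_mul pscal ('X_ord0)%:P
  | WeylD => twist_op base_field
  end.

Fact rep_weyl_respects : respects_relations (@weyl_rel k) rep_weyl_gen.
Proof.
move=> _ _ [] /=; rewrite scale1r; apply: endo_ext => P /=.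
by rewrite /twist_fun twistMl derX /base_field eqxx polyC1 mul1r addrC.
Qed.

Definition rep_weyl : weyl k -> endo pscal := plift rep_weyl_respects.
HB.instance Definition _ := GRing.RMorphism.copy rep_weyl (plift rep_weyl_respects).
HB.instance Definition _ := GRing.Linear.copy rep_weyl (plift rep_weyl_respects).

Definition rep_jet (x : gquot k n) : endo pscal :=
  twist_op (lie_field (witt0_val (generic_quotient.repr x : witt0 k))).

Lemma lie_field_lin a g h l :
  lie_field (a *: g + h) l = scal a * lie_field g l + lie_field h l.
Proof.
case: (unliftP ord0 l) => [j|] ->; last by rewrite !lie_field0 mulr0 addr0.
by rewrite !lie_fieldS mulrDl derivD vertD -scalerAl derivZ vertZ.
Qed.

Lemma twist_op_lin a c1 c2 :
  twist_op (fun l => scal a * c1 l + c2 l) = a *: twist_op c1 + twist_op c2.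
Proof.
by apply: endo_ext => P; rewrite /= /twist_fun twistDl twistZl.
Qed.

(** The choice of a representative does not matter: the field of [w] depends
   only on its coefficients up to degree [n]. *)
Lemma rep_jetE (w : witt0 k) :
  rep_jet (lieq (witt_ge_ideal k n) w) = twist_op (lie_field (witt0_val w)).
Proof.
rewrite /rep_jet; set w' := generic_quotient.repr _.
have /witt_geP w0 : witt0_val (w' - w) \in witt_ge n.
  exact: (lieq_reprP (witt_ge_ideal k n) w).
have -> : witt0_val w' = 1 *: witt0_val (w' - w) + witt0_val w.
  by rewrite scale1r /= subrK.
apply: twist_op_ext => l; rewrite lie_field_lin lie_field_eq0 //.
by rewrite mulr0 add0r.
Qed.

Fact rep_jet_is_linear : linear rep_jet.
Proof.
move=> a; apply: lieq_surj => u; apply: lieq_surj => v.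
rewrite -linearP !rep_jetE -twist_op_lin; apply: twist_op_ext => l.
exact: (lie_field_lin a (witt0_val u) (witt0_val v)).
Qed.
HB.instance Definition _ := GRing.isLinear.Build k (gquot k n) (endo pscal) _
  rep_jet rep_jet_is_linear.

Fact rep_jet_lie (x y : gquot k n) :
  rep_jet (lie x y) = rep_jet x * rep_jet y - rep_jet y * rep_jet x.
Proof.
move: x; apply: lieq_surj => u; move: y; apply: lieq_surj => v.
rewrite -[lie _ _]lieq_lieE !rep_jetE -twist_op_bracket; apply: twist_op_ext => l.
have w0 (w : witt0 k) : (witt0_val w : {poly k})`_0 = 0.
  by have /witt_geP -> := witt0P w.
by rewrite lie_field_bracket.
Qed.

Definition rep_env : env (gquot k n) -> endo pscal := env_lift rep_jet_lie.
HB.instance Definition _ := GRing.LRMorphism.on rep_env.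

Lemma vf_bracket_base g : vf_bracket base_field (lie_field g) =1 fun=> 0.
Proof.
move=> l; rewrite /vf_bracket /base_field.
have -> : der (lie_field g) (l == ord0)%:R = 0.
  by rewrite -(rmorph_nat (@mpolyC n.+1 K)) derC.
rewrite subr0; case: (unliftP ord0 l) => [j|] ->; last by rewrite lie_field0 raddf0.
rewrite lie_fieldS /vert raddf_sum big1 //= => i _.
by rewrite der_scal derX eq_sym (negPf (neq_lift _ _)) mulr0.
Qed.

(** The fields [lie_field g] neither involve nor move the coordinate [t]. *)
Lemma rep_weyl_jet_comm (w : weyl_gen) (x : gquot k n) :
  rep_weyl_gen w * rep_jet x = rep_jet x * rep_weyl_gen w.
Proof.
move: x; apply: lieq_surj => x; rewrite rep_jetE; case: w => /=.
  apply: endo_ext => P; rewrite /= /twist_fun twistMl derX lie_field0.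
  by rewrite polyC0 mul0r add0r.
apply/eqP; rewrite -subr_eq0 -twist_op_bracket; apply/eqP.
rewrite (twist_op_ext (vf_bracket_base (witt0_val x))); apply: endo_ext => P.
have d0 r : der (fun=> 0) r = 0 :> R0 by rewrite /der big1 // => l _; rewrite mul0r.
rewrite /= /twist_fun /twist d0 polyC0 mulr0 mul0r addr0.
by apply/polyP => i; rewrite coef_pder d0 coef0.
Qed.

Fact rep_comm a b : rep_weyl a * rep_env b = rep_env b * rep_weyl a.
Proof.
have commD (A : pzRingType) (x y z : A) : x * y = y * x -> x * z = z * x ->
  x * (y + z) = (y + z) * x by rewrite mulrDr mulrDl => -> ->.
have commM (A : pzRingType) (x y z : A) : x * y = y * x -> x * z = z * x ->
  x * (y * z) = (y * z) * x by move=> xy xz; rewrite mulrA xy -mulrA xz mulrA.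
move: b; apply: presented_ind => [x|c|x y IHx IHy|x y IHx IHy].
- rewrite [rep_env _]env_liftE; move: a; apply: presented_ind => [w|c|a a' IH IH'|a a' IH IH'].
  + rewrite [rep_weyl _]plift_gen; exact: rep_weyl_jet_comm.
  + have -> : rep_weyl (c *: (1 : weyl k)) = c *: 1 by rewrite linearZ rmorph1.
    by rewrite -scalerAl -scalerAr mul1r mulr1.
  + by have := commD _ _ _ _ (esym IH) (esym IH'); rewrite -raddfD => /esym.
  + by have := commM _ _ _ _ (esym IH) (esym IH'); rewrite -rmorphM => /esym.
- have -> : rep_env (c *: (1 : env _)) = c *: 1 by rewrite linearZ rmorph1.
  by rewrite -scalerAl -scalerAr mul1r mulr1.
- by have := commD _ _ _ _ IHx IHy; rewrite -raddfD.
- by have := commM _ _ _ _ IHx IHy; rewrite -rmorphM.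
Qed.

Definition rep : orbit_alg k n -> endo pscal := tens_lift rep_comm.
HB.instance Definition _ := GRing.RMorphism.copy rep (tens_lift rep_comm).
HB.instance Definition _ := GRing.Linear.copy rep (tens_lift rep_comm).

Definition at_base (f : {poly k}) : R0 := (map_poly scal f).['X_ord0].

Lemma rep_weyl_poly f P : rep_weyl (weyl_poly f) P = (at_base f)%:P * P.
Proof.
elim/poly_ind: f P => [|f c IH] P.
  by rewrite /at_base !rmorph0 horner0 polyC0 mul0r.
have tE : rep_weyl (weyl_t k) = endo_mul pscal ('X_ord0)%:P by exact: plift_gen.
have -> : weyl_poly (f * 'X + c%:P) = weyl_poly f * weyl_t k + c *: 1.
  by rewrite rmorphD rmorphM /= /weyl_poly horner_algX horner_algC.
rewrite rmorphD rmorphM /=.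
rewrite linearZ /= rmorph1 tE /= IH /at_base rmorphD rmorphM /=.
rewrite map_polyX map_polyC hornerMXaddC polyCD polyCM mulrDl -/(at_base f).
by rewrite mulrA.
Qed.

Lemma rep_tens a b : rep (tens a b) = rep_weyl a * rep_env b.
Proof. exact: tens_liftE. Qed.

Lemma endo_sum I (r : seq I) (F : I -> endo pscal) P :
  (\sum_(i <- r) F i) P = \sum_(i <- r) F i P.
Proof.
by elim: r => [|i r IH]; rewrite ?big_nil // !big_cons /= -IH.
Qed.

Lemma rep_psi (f : {poly k}) P : rep (psi k n f) P =
  (at_base f)%:P * twist_fun base_field P
  + \sum_(i < n) (at_base f^`N(i.+1))%:P * twist_fun (lie_field 'X^(i.+1)) P.
Proof.
have wd : rep_weyl (weyl_d k) = twist_op base_field by exact: plift_gen.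
rewrite /psi rmorphD /= rep_tens rmorph1 mulr1 rmorphM /= rep_weyl_poly wd.
congr +%R; rewrite rmorph_sum endo_sum; apply: eq_bigr => i _.
have vE : rep_jet (gquot_v k n i) = twist_op (lie_field 'X^(i.+1)).
  by rewrite [LHS]rep_jetE /= /witt_e -PoszD absz_nat addn1.
by rewrite /= rep_tens [rep_env _](etrans (env_liftE _ _) vE) /= rep_weyl_poly.
Qed.

(** The factor by which [f d/dt] multiplies the top coefficient; see
   [coef_rep_psi]. *)
Definition symbol (f : {poly k}) : R0 := at_base f * der base_field phase
  + \sum_(i < n) at_base f^`N(i.+1) * der (lie_field 'X^(i.+1)) phase.

Lemma size_rep_psi (f : {poly k}) P d :
  (size P <= d)%N -> (size (rep (psi k n f) P) <= d.+1)%N.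
Proof.
move=> Pd; have sz r c : (size (r%:P * twist_fun c P)%R <= d.+1)%N.
  by rewrite mul_polyC (leq_trans (size_scale_leq _ _)) ?size_twist.
rewrite rep_psi; apply: leq_trans (size_polyD _ _) _; rewrite geq_max sz /=.
by apply: leq_trans (size_sum _ _ _) _; apply/bigmax_leqP.
Qed.

Lemma coef_rep_psi (f : {poly k}) P d :
  (size P <= d.+1)%N -> (rep (psi k n f) P)`_d.+1 = symbol f * P`_d.
Proof.
move=> Pd; have cf r c : (r%:P * twist_fun c P)`_d.+1 = r * der c phase * P`_d.
  by rewrite coefCM coef_twist nth_default // raddf0 add0r mulrA.
rewrite rep_psi coefD cf coef_sum /symbol mulrDl mulr_suml; congr +%R.
by apply: eq_bigr => i _; rewrite cf.
Qed.

Definition field_word (s : seq {poly k}) : env (witt k) :=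
  \prod_(f <- s) env_gen (f : witt k).

Definition orbit_act (x : env (witt k)) : {poly R0} := rep (Psi k n x) 1.

Lemma orbit_act_field_word s : (size (orbit_act (field_word s)) <= (size s).+1)%N /\
  (orbit_act (field_word s))`_(size s) = \prod_(f <- s) symbol f.
Proof.
elim: s => [|f s [IHs IHc]].
  by rewrite /orbit_act /field_word !big_nil !rmorph1 /= size_poly1 coef1.
have -> : orbit_act (field_word (f :: s)) = rep (psi k n f) (orbit_act (field_word s)).
  by rewrite /orbit_act /field_word big_cons !rmorphM /= [Psi k n (env_gen _)]env_liftE.
by split; rewrite ?size_rep_psi //= coef_rep_psi // IHc big_cons.
Qed.

Variable t : K.

Definition base_point (l : 'I_n.+1) : K :=
  if unlift ord0 l is Some j then if j.+1 == n then iota n%:R^-1 else 0 else t.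

Definition jet_symbol (f : {poly k}) : K :=
  \sum_(l < n.+1) (map_poly iota f^`N(l)).[t] * zeta l.

Lemma der_phase c : der c phase =
  (zeta 0)%:MP * c ord0 + \sum_(j < n) (zeta (n - j))%:MP * c (lift ord0 j).
Proof.
have dM (a : K) r : der c (a%:MP * r) = a%:MP * der c r :> R0.
  by rewrite derM derC mul0r add0r.
rewrite /phase raddfD /= dM derX raddf_sum; congr +%R.
by apply: eq_bigr => j _; rewrite /= dM derX.
Qed.

Lemma meval_vert p : (0 < n)%N ->
  (vert p).@[base_point] = iota (p`_n.-1 / n%:R).
Proof.
move=> n_gt0; have lt : (n.-1 < n)%N by rewrite prednK.
rewrite /vert raddf_sum /= (bigD1 (Ordinal lt)) //= big1 => [|j /eqP jE].
  rewrite addr0 mevalM mevalC mevalXU /base_point liftK /= prednK // eqxx.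
  by rewrite rmorphM.
rewrite mevalM mevalC mevalXU /base_point liftK.
case: eqP => [jn|_]; last by rewrite mulr0.
by case: jE; apply/val_inj/(congr1 predn jn).
Qed.

(** At [base_point] the only form with nonzero coordinate is [t^(n - 1) dt],
   whose coordinate [1/n] compensates the factor [n] of the Lie derivative. *)
Lemma meval_symbol (f : {poly k}) : [pchar k] =i pred0 ->
  (symbol f).@[base_point] = jet_symbol f.
Proof.
move=> char0.
have mb (p : {poly k}) : (at_base p).@[base_point] = (map_poly iota p).[t].
  rewrite -horner_map /= mevalXU -map_poly_comp /base_point unlift_none.
  by congr (_.[_]); apply: eq_map_poly => a /=; rewrite mevalC.
have base : (der base_field phase).@[base_point] = zeta 0.
  rewrite der_phase [X in _ + X]big1 => [|j _]; last first.
    by rewrite /base_field eq_sym (negPf (neq_lift _ _)) mulr0.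
  by rewrite addr0 /base_field eqxx mulr1 mevalC.
have jet (i : 'I_n) : (der (lie_field 'X^(i.+1)) phase).@[base_point] = zeta i.+1.
  have n_gt0 : (0 < n)%N by apply: leq_ltn_trans (ltn_ord i).
  rewrite der_phase lie_field0 mulr0 add0r [LHS]raddf_sum.
  rewrite (bigD1 (rev_ord i)) //= big1 => [|j /eqP ji].
    rewrite addr0 mevalM mevalC lie_fieldS meval_vert // -exprD coef_deriv coefXn.
    rewrite prednK //= subnKC // eqxx subKn // mulfV ?rmorph1 ?mulr1 //.
    by rewrite ((pcharf0P k).1 char0) -lt0n.
  rewrite mevalM mevalC lie_fieldS meval_vert // -exprD coef_deriv coefXn.
  rewrite prednK //; case: eqP => [nE|_]; last by rewrite mul0rn mul0r rmorph0 mulr0.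
  by case: ji; apply/val_inj; rewrite /= -[LHS](addKn i.+1) -nE.
rewrite /symbol mevalD mevalM mb base [X in _ + X]raddf_sum /jet_symbol.
rewrite big_ord_recl nderivn0; congr +%R.
by apply: eq_bigr => i _; rewrite /= mevalM mb jet.
Qed.

Definition top_symbol d x : K := ((orbit_act x)`_d).@[base_point].

Lemma top_symbol_ker d x : Psi k n x = 0 -> top_symbol d x = 0.
Proof.
by move=> x0; rewrite /top_symbol /orbit_act x0 rmorph0 /= coef0 meval0.
Qed.

Lemma top_symbolD d x y : top_symbol d (x + y) = top_symbol d x + top_symbol d y.
Proof. by rewrite /top_symbol /orbit_act !rmorphD /= coefD mevalD. Qed.

Lemma top_symbolZ d a x : top_symbol d (a *: x) = iota a * top_symbol d x.
Proof.
by rewrite /top_symbol /orbit_act !linearZ /= coefCM mevalM mevalC.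
Qed.

(** Each factor raises the degree in [lambda] by at most one, and multiplies
   the top coefficient by its symbol. *)
Lemma top_symbol_field_word d s : [pchar k] =i pred0 -> (size s <= d)%N ->
  top_symbol d (field_word s) = if size s == d then \prod_(f <- s) jet_symbol f else 0.
Proof.
move=> char0 sd; have [sz cf] := orbit_act_field_word s; rewrite /top_symbol.
case: eqP => [<-|/eqP sd']; last first.
  by rewrite nth_default ?meval0 // (leq_trans sz) // ltn_neqAle sd'.
rewrite cf rmorph_prod /=; apply: eq_bigr => f _; exact: meval_symbol.
Qed.
End Representation.

(** * Linear spans, words and the length filtration *)
Section Span.
Variables (k : fieldType) (V : lmodType k).

Inductive lin_span (S : V -> Prop) : V -> Prop :=
| lin_span0 : lin_span S 0
| lin_spanS a x y : S x -> lin_span S y -> lin_span S (a *: x + y).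

Definition subspace (P : V -> Prop) : Prop :=
  P 0 /\ forall a x y, P x -> P y -> P (a *: x + y).

Lemma lin_span_min (S P : V -> Prop) : subspace P -> (forall x, S x -> P x) ->
  forall x, lin_span S x -> P x.
Proof.
move=> [P0 PP] SP x; elim=> // a y z Sy _ Pz.
by apply: PP => //; apply: SP.
Qed.

Lemma lin_span_subspace S : subspace (lin_span S).
Proof.
split=> [|a x y Sx Sy]; first exact: lin_span0.
elim: Sx => [|b x' y' Sx' _ IH]; first by rewrite scaler0 add0r.
by rewrite scalerDr scalerA -addrA; apply: lin_spanS.
Qed.

Lemma lin_span_gen (S : V -> Prop) x : S x -> lin_span S x.
Proof.
by move=> Sx; rewrite -[x]addr0 -[x]scale1r; apply/lin_spanS/lin_span0.
Qed.

Section Closure.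
Variables (P : V -> Prop) (Psub : subspace P).
Lemma subspaceD x y : P x -> P y -> P (x + y).
Proof. by move=> Px Py; rewrite -[x]scale1r; apply Psub. Qed.
Lemma subspaceZ a x : P x -> P (a *: x).
Proof. by move=> Px; rewrite -[_ *: _]addr0; apply Psub => //; case: Psub. Qed.
Lemma subspaceB x y : P x -> P y -> P (x - y).
Proof. by move=> Px Py; rewrite -scaleN1r addrC; apply Psub. Qed.
Lemma subspace_sum I (r : seq I) (F : I -> V) :
  (forall i, P (F i)) -> P (\sum_(i <- r) F i).
Proof.
move=> PF; elim: r => [|i r IH]; first by rewrite big_nil; case: Psub.
by rewrite big_cons; apply: subspaceD.
Qed.
End Closure.
End Span.

Section Filtration.
Variable k : fieldType.
Local Notation U := (env (witt k)).
Implicit Types (s u v : seq nat) (x y z : U).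

(** The letter [j] is the basis vector [e_(j - 1)]. *)
Definition letter (j : nat) : U := env_gen ('X^j : witt k).
Definition letter_word s : U := \prod_(j <- s) letter j.

Lemma letter_word_cat s u : letter_word (s ++ u) = letter_word s * letter_word u.
Proof. exact: big_cat. Qed.
Lemma letter_word_cons j s : letter_word (j :: s) = letter j * letter_word s.
Proof. exact: big_cons. Qed.
Lemma letter_word1 j : letter_word [:: j] = letter j.
Proof. exact: big_seq1. Qed.

Definition filtered d : U -> Prop :=
  lin_span (fun x => exists2 s, (size s <= d)%N & x = letter_word s).

Lemma filtered_subspace d : subspace (filtered d).
Proof. exact: lin_span_subspace. Qed.

Lemma filtered_word s d : (size s <= d)%N -> filtered d (letter_word s).
Proof. by move=> sd; apply: lin_span_gen; exists s. Qed.

Lemma filtered_le d e x : (d <= e)%N -> filtered d x -> filtered e x.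
Proof.
move=> de; apply: lin_span_min; first exact: filtered_subspace.
by move=> _ [s sd ->]; apply/filtered_word/leq_trans/de.
Qed.

Lemma filteredM d e x y : filtered d x -> filtered e y -> filtered (d + e) (x * y).
Proof.
move=> dx ey; move: x dx; apply: lin_span_min.
  split=> [|a x x' fx fx']; first by rewrite mul0r; case: (filtered_subspace (d + e)).
  by rewrite mulrDl -scalerAl; apply filtered_subspace.
move=> _ [s sd ->]; move: y ey; apply: lin_span_min.
  split=> [|a x x' fx fx']; first by rewrite mulr0; case: (filtered_subspace (d + e)).
  by rewrite mulrDr -scalerAr; apply filtered_subspace.
move=> _ [u ue ->]; rewrite -letter_word_cat.
by apply: filtered_word; rewrite size_cat leq_add.
Qed.

Lemma filtered_letter j : filtered 1 (letter j).
Proof. by rewrite -letter_word1; apply: filtered_word. Qed.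

Lemma letter_comm i j : letter i * letter j - letter j * letter i =
  (j%:R - i%:R) *: letter (i + j).-1.
Proof.
rewrite -env_gen_lie -[RHS]linearZ; congr env_gen.
change (witt_lie 'X^i 'X^j = (j%:R - i%:R) *: ('X^((i + j).-1) : {poly k})).
rewrite /witt_lie !derivXn scalerBl !scaler_nat mulrnAr mulrnAl.
case: i j => [|i] [|j]; rewrite ?mulr0n ?addn0 ?add0n ?subr0 ?sub0r //=.
- by rewrite expr0 mul1r.
- by rewrite expr0 mulr1.
by rewrite -!exprD addSnnS addnS.
Qed.

Lemma letter_word_comm i s :
  filtered (size s) (letter i * letter_word s - letter_word s * letter i).
Proof.
elim: s => [|j s IH] /=.
  by rewrite /letter_word big_nil mulr1 mul1r subrr; case: (filtered_subspace 0).
rewrite letter_word_cons.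
have -> : letter i * (letter j * letter_word s) - letter j * letter_word s * letter i =
  (letter i * letter j - letter j * letter i) * letter_word s
  + letter j * (letter i * letter_word s - letter_word s * letter i).
  by rewrite mulrBl mulrBr !mulrA addrA subrK.
apply: (subspaceD (filtered_subspace _)); last first.
  by rewrite -add1n; apply: filteredM IH; apply: filtered_letter.
rewrite letter_comm -scalerAl; apply: (subspaceZ (filtered_subspace _)).
by rewrite -letter_word_cons; apply: filtered_word.
Qed.

(** Products commute up to shorter ones, because commutators of letters are
   multiples of letters. *)
Lemma letter_word_perm s u : perm_eq s u ->
  filtered (size s).-1 (letter_word s - letter_word u).
Proof.
elim: s u => [|j s IH] u.
  rewrite perm_sym => /perm_nilP ->; rewrite subrr; by case: (filtered_subspace 0).
move=> su; have : j \in u by rewrite -(perm_mem su) mem_head.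
move: su => /[swap] /splitPr [u1 u2].
rewrite -[j :: u2]cat1s perm_sym perm_catCA perm_sym /= perm_cons => su.
have sz : size s = (size u1 + size u2)%N by rewrite (perm_size su) size_cat.
have -> : letter_word (j :: s) - letter_word (u1 ++ j :: u2) =
    letter j * (letter_word s - letter_word (u1 ++ u2))
    + (letter j * letter_word u1 - letter_word u1 * letter j) * letter_word u2.
  by rewrite !letter_word_cat !letter_word_cons mulrBl mulrBr !mulrA addrA subrK.
apply: (subspaceD (filtered_subspace _)) => /=; last first.
  by rewrite sz; apply: filteredM; [apply: letter_word_comm | apply: filtered_word].
case: s su sz IH => [|i s] su sz IH.
  have -> : u1 ++ u2 = [::] by apply/perm_nilP; rewrite perm_sym.
  by rewrite subrr mulr0; case: (filtered_subspace 0).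
by rewrite /= -add1n; apply: filteredM (filtered_letter _) (IH _ su).
Qed.

Lemma filtered_exhaustive x : exists d, filtered d x.
Proof.
move: x; apply: presented_ind => [f|a|x y [d dx] [e ey]|x y [d dx] [e ey]].
- exists 1%N; rewrite -/(env_gen f) -[f](coefK (f : {poly k})) poly_def.
  rewrite [env_gen _]raddf_sum; apply: (subspace_sum (filtered_subspace _)) => i.
  by rewrite /= linearZ; apply/(subspaceZ (filtered_subspace _))/filtered_letter.
- exists 0%N; apply: (subspaceZ (filtered_subspace _)).
  by have := @filtered_word [::] 0 isT; rewrite /letter_word big_nil.
- exists (maxn d e); apply: (subspaceD (filtered_subspace _)).
    by apply: filtered_le dx; rewrite leq_maxl.
  by apply: filtered_le ey; rewrite leq_maxr.
- by exists (d + e)%N; apply: filteredM.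
Qed.

Section Normal.
Variable n : nat.
Local Notation A := {mpoly k[n.+1]}.
Implicit Types (p q : A) (m : 'X_{1..n.+1}).

(** The linear map sending a commutative monomial to the product of the same
   letters in increasing order.  It is not multiplicative, but becomes so
   modulo shorter words; see [orderedM_letter]. *)
Definition ordered p : U := mmap (in_alg U) (fun i : 'I_n.+1 => letter i) p.

Definition mnm_seq m : seq nat := flatten [seq nseq (m i) (i : nat) | i <- index_enum 'I_n.+1].

Lemma orderedX m : ordered 'X_[m] = letter_word (mnm_seq m).
Proof.
rewrite /ordered mmapX /mmap1 /mnm_seq /letter_word big_flatten big_map /=.
by apply: eq_bigr => i _; rewrite big_nseq -[RHS]Monoid.iteropE.
Qed.

Lemma size_mnm_seq m : size (mnm_seq m) = mdeg m.
Proof.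
rewrite size_flatten sumnE /shape -map_comp big_map mdegE.
by apply: eq_bigr => i _; rewrite /= size_nseq.
Qed.

Lemma count_mnm_seq m (j : nat) : count_mem j (mnm_seq m) =
  if insub j is Some i then m i else 0%N.
Proof.
rewrite count_flatten -map_comp sumnE big_map /=.
under eq_bigr => i _ do rewrite count_nseq /=.
case: insubP => [i _ <-|jn].
  rewrite (bigD1 i) //= eqxx mul1n big1 ?addn0 // => i' ii'.
  by rewrite (inj_eq val_inj) (negPf ii').
rewrite big1 // => i _; case: eqP => [ij|]; last by rewrite mul0n.
by rewrite -ij ltn_ord in jn.
Qed.

Lemma perm_mnm_seq (s : seq nat) : all (fun j => j <= n)%N s ->
  exists2 m, mdeg m = size s & perm_eq s (mnm_seq m).
Proof.
move=> sn; pose m : 'X_{1..n.+1} := [multinom count_mem (i : nat) s | i < n.+1].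
have sm : perm_eq s (mnm_seq m).
  apply/allP => j _; rewrite /= count_mnm_seq; case: insubP => [i _ <-|jn].
    by rewrite mnmE.
  apply/eqP/count_memPn/negP => /(allP sn) jn'; by rewrite ltnS jn' in jn.
by exists m => //; rewrite -size_mnm_seq (perm_size sm).
Qed.
End Normal.
End Filtration.

(** * Finite differences and interpolation *)
Section Differences.
Variables (k : fieldType) (V : lmodType k).
Implicit Types (x y : nat -> V).

(** As in the differentiators, the coefficient [1] is at [x j], rather than at
   [x (j + m)]. *)
Definition fdiff m x j : V := \sum_(i < m.+1) ((-1) ^+ i *+ 'C(m, i)) *: x (j + i)%N.

Lemma fdiff0 x j : fdiff 0 x j = x j.
Proof. by rewrite /fdiff big_ord1 bin0 expr0 mulr1n scale1r addn0. Qed.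

Lemma fdiffS m x j : fdiff m.+1 x j = fdiff m (fun q => x q - x q.+1) j.
Proof.
rewrite /fdiff; under [RHS]eq_bigr do rewrite scalerBr.
rewrite sumrB big_ord_recl /= bin0 [X in _ = X - _]big_ord_recl /= bin0 -!addrA.
congr +%R; under eq_bigr => i _ do rewrite /bump /= add1n binS mulrnDr scalerDl.
rewrite big_split /=; congr +%R.
  by rewrite big_ord_recr /= bin_small // mulr0n scale0r addr0.
rewrite -sumrN; apply: eq_bigr => i _; rewrite exprS mulN1r mulNrn scaleNr.
by rewrite addnS.
Qed.

(** Newton's forward difference formula modulo a subspace: a sequence on
   [0, ..., N] whose [m]-th differences vanish is polynomial of degree less
   than [m]. *)
Lemma newton_mod (P : V -> Prop) m N x : subspace P ->
  (forall j, (j + m <= N)%N -> P (fdiff m x j)) ->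
  exists y, forall i, (i <= N)%N -> P (x i - \sum_(r < m) 'C(i, r)%:R *: y r).
Proof.
move=> Psub; have P0 : P 0 by case: Psub.
elim: m N x => [|m IH] N x xP.
  exists (fun=> 0) => i iN; rewrite big_ord0 subr0 -fdiff0.
  by apply: xP; rewrite addn0.
have [y yP] : exists y, forall i, (i < N)%N ->
    P (x i - x i.+1 - \sum_(r < m) 'C(i, r)%:R *: y r).
  case: N xP => [|N] xP; first by exists (fun=> 0).
  by apply: IH => j jN; rewrite -fdiffS; apply: xP; rewrite addnS.
pose y1 r := if r is r'.+1 then - y r' else x 0%N.
exists y1; elim=> [|i IHi] iN.
  by rewrite big_ord_recl /= scale1r big1 ?addr0 ?subrr // => r _; rewrite scale0r.
set t := \sum_(r < m) 'C(i, r)%:R *: y r.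
have -> : \sum_(r < m.+1) 'C(i.+1, r)%:R *: y1 r
    = \sum_(r < m.+1) 'C(i, r)%:R *: y1 r - t.
  rewrite !big_ord_recl /= !bin0 -addrA; congr +%R.
  rewrite -sumrB; apply: eq_bigr => r _.
  by rewrite binS natrD scalerDl; congr +%R; apply: scalerN.
rewrite opprB addrA -(subrK (x i) (x i.+1 + t)) -addrA -(opprK (_ - x i)) addrC.
apply: (subspaceB Psub); first exact/IHi/ltnW.
by rewrite opprB opprD addrA; apply: yP.
Qed.
End Differences.

Section Interpolation.
Variables (k : fieldType) (char0 : [pchar k] =i pred0).

Lemma natr_inj (i j : nat) : i%:R = j%:R :> k -> i = j.
Proof.
wlog ij : i j / (i <= j)%N => [th|].
  by case/orP: (leq_total i j) => [ij|ji] e; [apply: th | apply/esym/th].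
move/eqP; rewrite eq_sym -subr_eq0 -natrB // ((pcharf0P k).1 char0) subn_eq0 => ji.
by apply/eqP; rewrite eqn_leq ij.
Qed.

Definition binpoly r : {poly k} := r`!%:R^-1 *: \prod_(0 <= q < r) ('X - q%:R%:P).

Lemma size_binpoly r : (size (binpoly r) <= r.+1)%N.
Proof.
by rewrite (leq_trans (size_scale_leq _ _)) // size_prod_XsubC size_iota subn0.
Qed.

Lemma horner_binpoly r (i : nat) : (binpoly r).[i%:R] = 'C(i, r)%:R.
Proof.
have fact0 : r`!%:R != 0 :> k by rewrite ((pcharf0P k).1 char0) -lt0n fact_gt0.
apply: (mulfI fact0); rewrite hornerZ mulrA mulfV // mul1r horner_prod.
rewrite -natrM mulnC bin_ffact.
elim: r {fact0} => [|r IH]; first by rewrite big_nil ffactn0.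
rewrite big_nat_recr //= IH ffactnSr hornerXsubC.
have [ri|ir] := leqP r i; first by rewrite natrM natrB.
by rewrite ffact_small // !mul0r.
Qed.

(** By [newton_mod] the terms of the sequence are values of a polynomial
   of degree less than [m] with vector coefficients, so each of them is a
   combination of the values at any [M >= m] nodes. *)
Lemma interpolate_mod (V : lmodType k) (P : V -> Prop) m N M (nu : nat -> nat)
    (x : nat -> V) i : subspace P ->
  (forall j, (j + m <= N)%N -> P (fdiff m x j)) ->
  (0 < M)%N -> (m <= M)%N -> injective nu -> (forall j, (j < M)%N -> (nu j <= N)%N) ->
  (i <= N)%N ->
  exists c : 'I_M -> k, P (x i - \sum_(j < M) c j *: x (nu j)).
Proof.
move=> Psub xP M_gt0 mM nu_inj nuN iN.
have [y yP] := newton_mod Psub xP.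
pose X j : k := (nu j)%:R.
have X_inj : injective X by move=> a b /natr_inj/nu_inj.
pose c (j : 'I_M) := (tnth (lagrange M X) j : {poly k}).[i%:R].
have cE r : (r < m)%N -> 'C(i, r)%:R = \sum_(j < M) c j * 'C(nu j, r)%:R.
  move=> rm; rewrite -horner_binpoly.
  rewrite [in LHS](lagrange_gen M_gt0 X_inj (p := binpoly r)); last first.
    exact: leq_trans (size_binpoly r) (leq_trans rm mM).
  rewrite horner_sum; apply: eq_bigr => j _.
  by rewrite hornerM hornerC horner_binpoly mulrC.
exists c.
have -> : x i - \sum_(j < M) c j *: x (nu j) =
   (x i - \sum_(r < m) 'C(i, r)%:R *: y r)
   - \sum_(j < M) c j *: (x (nu j) - \sum_(r < m) 'C(nu j, r)%:R *: y r).
  under [X in _ = _ - X]eq_bigr do rewrite scalerBr scaler_sumr.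
  rewrite sumrB opprB addrA; congr (_ - _); rewrite exchange_big /=.
  rewrite -addrA addrC; apply/eqP; rewrite -subr_eq subrr eq_sym addrC subr_eq0; apply/eqP.
  apply: eq_bigr => r _; rewrite cE // scaler_suml.
  by apply: eq_bigr => j _; rewrite scalerA.
apply: (subspaceB Psub); first exact: yP.
apply: (subspace_sum Psub) => j; apply: (subspaceZ Psub); apply/yP/nuN/ltn_ord.
Qed.
End Interpolation.

(** * Normal forms modulo the left ideal *)
Section Normal.
Variables (k : fieldType) (n : nat).
Local Notation U := (env (witt k)).
Local Notation A := {mpoly k[n.+1]}.
Implicit Types (p : A) (q : {poly A}) (m : 'X_{1..n.+1}).

Lemma orderedZ a p : ordered (a *: p) = a *: ordered p.
Proof. by rewrite /ordered mmapZ /= -scalerAl mul1r. Qed.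

Lemma orderedD p p' : ordered (p + p') = ordered p + ordered p'.
Proof. exact: mmapD. Qed.

Lemma ordered_expand p :
  ordered p = \sum_(m <- msupp p) p@_m *: letter_word k (mnm_seq m).
Proof.
rewrite {1}(mpolyE p) (big_morph _ orderedD (mmap0 _ _)).
by apply: eq_bigr => m _; rewrite orderedZ orderedX.
Qed.

(** Inserting a small letter at its place only produces shorter words. *)
Lemma orderedM_letter d p (i : 'I_n.+1) : p \is d.-homog ->
  filtered d (ordered p * letter k i - ordered (p * 'X_i)).
Proof.
move=> /dhomogP pd; have Fd := filtered_subspace k d.
have -> : ordered (p * 'X_i) = \sum_(m <- msupp p) p@_m *: letter_word k (mnm_seq (m + U_(i))).
  rewrite {1}(mpolyE p) mulr_suml (big_morph _ orderedD (mmap0 _ _)).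
  by apply: eq_bigr => m _; rewrite -scalerAl orderedZ -mpolyXD orderedX.
rewrite ordered_expand mulr_suml -sumrB big_seq.
apply: (big_ind (filtered d)) => [|x y dx dy|m mp]; [by case: Fd|exact: (subspaceD Fd)|].
rewrite -scalerAl -scalerBr; apply: (subspaceZ Fd).
rewrite -letter_word1 -letter_word_cat.
have -> : d = (size (mnm_seq m ++ [:: (i : nat)])).-1.
  by rewrite size_cat addn1 size_mnm_seq (pd m mp).
apply: letter_word_perm; apply/allP => j _; rewrite /= count_cat !count_mnm_seq /= addn0.
case: insubP => [j' _ <-|]; first by rewrite mnmDE mnm1E.
by move=> jn; case: (_ i =P j) => // ij; rewrite -ij ltn_ord in jn.
Qed.

(** In a normal form the last letter is arbitrary and recorded by the exponent
   of ['X]; the preceding ones are small and recorded by the coefficients. *)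
Definition normal q : U := \sum_(b < size q) ordered q`_b * letter k b.

Lemma normal_widen q B : (size q <= B)%N ->
  normal q = \sum_(b < B) ordered q`_b * letter k b.
Proof.
move=> qB; rewrite /normal (big_ord_widen B (fun b => ordered q`_b * letter k b)) //.
rewrite big_mkcond; apply: eq_bigr => b _; case: ifP => // /negbT.
by rewrite -leqNgt => qb; rewrite nth_default // /ordered mmap0 mul0r.
Qed.

Lemma normalP a q q' : normal (a%:MP *: q + q') = a *: normal q + normal q'.
Proof.
pose B := maxn (size q) (size q').
have qB : (size q <= B)%N by rewrite leq_maxl.
have q'B : (size q' <= B)%N by rewrite leq_maxr.
rewrite (normal_widen qB) (normal_widen q'B) (@normal_widen _ B).
  rewrite scaler_sumr -big_split /=; apply: eq_bigr => b _.
  by rewrite coefD coefZ mul_mpolyC orderedD orderedZ mulrDl -scalerAl.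
rewrite (leq_trans (size_polyD _ _)) // geq_max q'B andbT.
exact: leq_trans (size_scale_leq _ _) qB.
Qed.

Section Reduction.
Variables (L : classical_sets.set U) (Lideal : left_ideal L).
Variables (m : nat) (mn : (m <= 2 * n + 2)%N) (char0 : [pchar k] =i pred0).
Hypothesis Ldiff : forall N j, (j + m <= N)%N ->
  L (fdiff m (fun i => letter k (N - i) * letter k i) j).

Lemma left_ideal_subspace : subspace L.
Proof.
case: Lideal => L0 LD LM; split=> // a x y Lx Ly; apply: LD => //.
by rewrite -[x]mul1r scalerAl; apply: LM.
Qed.

Definition reducible d (x : U) : Prop := exists2 q : {poly A},
  forall b, q`_b \is d.-homog & exists2 l, L l & filtered d (x - l - normal q).

Lemma reducible_subspace d : subspace (reducible d).
Proof.
have Fd := filtered_subspace k d; have Ls := left_ideal_subspace.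
split=> [|a x y [q qh [l Ll ql]] [q' qh' [l' Ll' ql']]].
  exists 0 => [b|]; first by rewrite coef0 dhomog0.
  exists 0; first by case: Ls.
  by rewrite /normal size_poly0 big_ord0 !subr0; case: Fd.
exists (a%:MP *: q + q') => [b|].
  by rewrite coefD coefZ mul_mpolyC dhomogD ?dhomogZ // qh.
exists (a *: l + l'); first by apply Ls.
have -> : a *: x + y - (a *: l + l') - normal (a%:MP *: q + q')
  = a *: (x - l - normal q) + (y - l' - normal q').
  by rewrite normalP !scalerBr !opprD (addrACA (a *: x) y) [LHS]addrACA.
by apply Fd.
Qed.

Lemma reducible_lower d x : filtered d x -> reducible d x.
Proof.
move=> dx; exists 0 => [b|]; first by rewrite coef0 dhomog0.
exists 0; first by case: left_ideal_subspace.
by rewrite /normal size_poly0 big_ord0 !subr0.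
Qed.

Lemma reducible_ideal d x : L x -> reducible d x.
Proof.
move=> Lx; exists 0 => [b|]; first by rewrite coef0 dhomog0.
exists x => //; rewrite /normal size_poly0 big_ord0 subr0 subrr.
by case: (filtered_subspace k d).
Qed.

(** When [N > 2n], the values at [j < 2n + 2] are the [n + 1] smallest and the
   [n + 1] largest indices in [0, ..., N].  The further values only make the map
   injective on all of [nat]. *)
Definition node N j : nat := if (j <= n)%N then j else (N + j - (2 * n + 1))%N.

(** Two large letters can be traded, modulo [L], for pairs with a small one, as
   one of [node N j] and [N - node N j] is at most [n]. *)
Lemma swap_large a b : (n < a)%N -> (n < b)%N -> exists c : 'I_(2 * n + 2) -> k,
  L (letter k a * letter k b - \sum_j c j *:
     (letter k (a + b - node (a + b) j) * letter k (node (a + b) j))).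
Proof.
move=> na nb; have [|||||c cP] := interpolate_mod (i := b) (M := 2 * n + 2)
  (nu := node (a + b)) char0 left_ideal_subspace (@Ldiff (a + b)).
- by rewrite addn2.
- exact: mn.
- by move=> i j; rewrite /node; case: ifP; case: ifP; lia.
- by move=> j; rewrite /node; case: ifP; lia.
- exact: leq_addl.
by exists c; rewrite addnK in cP.
Qed.

(** Induction on the number of large letters: as long as there are two of
   them, they can be moved to the end of the word, where the left ideal allows
   to trade them for a pair with fewer large letters. *)
Lemma reducible_word d s : size s = d.+1 -> reducible d (letter_word k s).
Proof.
have Rd := reducible_subspace d; pose big j := (n < j)%N.
elim: {s}_.+1 {-2}s (ltnSn (count big s)) => // c IH s; rewrite ltnS => sc sd.
have move_perm u : perm_eq s u -> reducible d (letter_word k u) ->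
    reducible d (letter_word k s).
  move=> su ru; rewrite -(subrK (letter_word k u) (letter_word k s)).
  apply: (subspaceD Rd) ru; apply: reducible_lower.
  by have := letter_word_perm k su; rewrite sd.
(* A large letter of [s] if there is one, and any letter otherwise. *)
have [x xs xbig] : exists2 x, x \in s & has big s -> big x.
  have [/hasP[x xs xb]|nh] := boolP (has big s); first by exists x.
  exists (head 0%N s) => //; case: s sd {sc move_perm nh} => //= j s _.
  by rewrite mem_head.
have su := perm_to_rem xs.
have [/hasP[y yu ybig]|small] := boolP (has big (rem x s)).
  have {}xbig : big x by apply/xbig/hasP; exists y => //; apply: mem_rem yu.
  set v := rem y (rem x s).
  have sv : perm_eq s (v ++ [:: x; y]).
    apply: perm_trans su _; rewrite perm_sym perm_catC /= perm_cons perm_sym.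
    exact: perm_to_rem.
  apply: (move_perm _ sv).
  have [a aP] := swap_large xbig ybig.
  have mon2 i j : letter_word k (v ++ [:: i; j]) = letter_word k v * (letter k i * letter k j).
    by rewrite letter_word_cat letter_word_cons letter_word1.
  rewrite mon2 -(subrK (\sum_j a j *: (letter k (x + y - node (x + y) j)
                                      * letter k (node (x + y) j))) (_ * letter k y)).
  rewrite mulrDr; apply: (subspaceD Rd).
    by apply: reducible_ideal; case: Lideal => _ _; apply.
  rewrite mulr_sumr; apply: (subspace_sum Rd) => j.
  rewrite -scalerAr; apply: (subspaceZ Rd); rewrite -mon2; apply: IH; last first.
    by rewrite -sd (perm_size sv) !size_cat.
  apply: leq_trans sc; have /permP/(_ big) -> := sv.
  rewrite !count_cat ltn_add2l /= xbig ybig /big /node.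
  have := ltn_ord j; move: xbig ybig; rewrite /big.
  case: ifP; lia.
have [m0 m0d um] : exists2 m0 : 'X_{1..n.+1}, mdeg m0 = size (rem x s)
    & perm_eq (rem x s) (mnm_seq m0).
  apply: perm_mnm_seq; apply/allP => j ju; rewrite leqNgt; apply/negP => jn.
  by case/hasP: small; exists j.
apply: (move_perm (mnm_seq m0 ++ [:: x])).
  by apply: perm_trans su _; rewrite perm_sym perm_catC /= perm_cons perm_sym.
exists ('X_[m0] *: 'X^x).
  move=> b; rewrite coefZ coefXn; case: eqP => _; last by rewrite mulr0 dhomog0.
  by rewrite mulr1 dhomogX /= m0d size_rem // sd.
exists 0; first by case: left_ideal_subspace.
have -> : normal ('X_[m0] *: 'X^x) = letter_word k (mnm_seq m0 ++ [:: x]).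
  rewrite (@normal_widen _ x.+1) => [|]; last first.
    by rewrite (leq_trans (size_scale_leq _ _)) // size_polyXn.
  rewrite big_ord_recr /= big1 => [|b _].
    by rewrite add0r coefZ coefXn eqxx mulr1 orderedX letter_word_cat letter_word1.
  by rewrite coefZ coefXn ltn_eqF // mulr0 /ordered mmap0 mul0r.
by rewrite subr0 subrr; case: (filtered_subspace k d).
Qed.

Lemma reducible_filtered d x : filtered d.+1 x -> reducible d x.
Proof.
apply: lin_span_min; first exact: reducible_subspace.
move=> _ [s sd ->]; move: sd; rewrite leq_eqVlt => /orP[/eqP|sd].
  exact: reducible_word.
by apply/reducible_lower/filtered_word.
Qed.
End Reduction.
End Normal.

(** * Symbols separate normal forms *)

Lemma alt_sum_bin (R : pzRingType) e b :
  \sum_(l < e.+1) ((-1) ^+ l *+ 'C(b.+1, l)) = (-1) ^+ e *+ 'C(b, e) :> R.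
Proof.
elim: e => [|e IH]; first by rewrite big_ord1 !bin0.
by rewrite big_ord_recr IH /= binS mulrnDr exprS mulN1r !mulNrn addrCA subrr addr0.
Qed.

Section Independence.
Variables (k : fieldType) (char0 : [pchar k] =i pred0) (n : nat).
Local Notation U := (env (witt k)).
Local Notation A := {mpoly k[n.+1]}.
Local Notation K := {poly A}.

Definition jet_const (a : k) : K := (a%:MP)%:P.
HB.instance Definition _ := GRing.RMorphism.copy jet_const (polyC \o @mpolyC n.+1 k).

Lemma coef_XaddC_exp (R : comNzRingType) (c : R) l r :
  (('X + c%:P) ^+ l)`_r = c ^+ (l - r) *+ 'C(l, r).
Proof.
rewrite addrC exprDn coef_sum.
under eq_bigr => i _ do rewrite -rmorphXn coefMn coefCM coefXn.
have [rl|lr] := ltnP r l.+1.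
  rewrite (bigD1 (Ordinal rl)) //= eqxx mulr1 big1 ?addr0 // => i ir.
  by rewrite eq_sym (_ : (_ == _) = false) ?mulr0 ?mul0rn //; apply: negPf.
rewrite bin_small // big1 // => i _; rewrite gtn_eqF ?mulr0 ?mul0rn //.
exact: leq_trans lr.
Qed.

(** A [k[t]]-linear functional on polynomials in [x], sending [x^r] to the
   variable [r] for [r <= n].  With the jet variable [l] defined as its value
   on [(x - t)^l], the symbol of [f d/dt] becomes its value on the Taylor
   polynomial of order [n] of [f] at [t]. *)
Definition eta (p : {poly K}) : K := \sum_(r < n.+1) p`_r * ('X_r)%:P.

Lemma etaD p q : eta (p + q) = eta p + eta q.
Proof. by rewrite /eta -big_split /=; apply: eq_bigr => r _; rewrite coefD mulrDl. Qed.

Lemma etaZ a p : eta (a *: p) = a * eta p.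
Proof. by rewrite /eta mulr_sumr; apply: eq_bigr => r _; rewrite coefZ mulrA. Qed.

Definition jet_var (l : nat) : K := eta (('X - ('X : K)%:P) ^+ l).

Definition letter_symbol (j : nat) : K := jet_symbol n jet_const jet_var 'X 'X^j.

Lemma letter_symbolE j :
  letter_symbol j = \sum_(l < n.+1) ('X^(j - l) *+ 'C(j, l)) * jet_var l.
Proof.
apply: eq_bigr => l _; congr *%R.
by rewrite nderivnXn raddfMn /= map_polyXn hornerMn hornerXn.
Qed.

(** A polynomial of degree at most [n] is its own Taylor polynomial. *)
Lemma letter_symbol_small (j : 'I_n.+1) : letter_symbol j = ('X_j)%:P.
Proof.
rewrite letter_symbolE.
have E : eta 'X^j = ('X_j)%:P.
  rewrite /eta (bigD1 j) //= coefXn eqxx mul1r big1 ?addr0 // => r rj.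
  by rewrite coefXn (_ : (_ == _) = false) ?mul0r //; apply: negPf.
(* Expand [x^j] as [((x - t) + t)^j]; the terms with [l > j] vanish. *)
rewrite -E -[in RHS](subrK (('X : K)%:P) 'X) addrC exprDn.
have [eta0 etas] : eta 0 = 0 /\ {morph eta : p q / p + q} by split;
  [rewrite /eta big1 // => r _; rewrite coef0 mul0r | exact: etaD].
rewrite (big_morph eta etas eta0).
rewrite (big_ord_widen n.+1 (fun l => eta (('X : K)%:P ^+ (j - l)
   * ('X - ('X : K)%:P) ^+ l *+ 'C(j, l)))) //.
rewrite [RHS]big_mkcond; apply: eq_bigr => l _; case: ifP => [_|/negbT].
  by rewrite -rmorphXn mul_polyC scalerMnl etaZ.
by rewrite -leqNgt => jl; rewrite bin_small // mulr0n mul0r.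
Qed.

Lemma jet_varE l :
  jet_var l = \sum_(r < n.+1) ((- 'X) ^+ (l - r) *+ 'C(l, r)) * ('X_r)%:P.
Proof.
by rewrite /jet_var /eta -polyCN; apply: eq_bigr => r _; rewrite coef_XaddC_exp.
Qed.

Lemma jet_var_term l r (c : A) : ((- 'X : K) ^+ (l - r) *+ 'C(l, r)) * c%:P =
  ((-1) ^+ (l - r) *+ 'C(l, r) * c) *: 'X^(l - r).
Proof.
have -> : (- 'X : K) ^+ (l - r) = ((-1) ^+ (l - r)) *: 'X^(l - r).
  by rewrite [LHS]exprNn -[RHS]mul_polyC polyC_exp polyCN polyC1.
by rewrite scalerMnl -scalerAl mulrC mul_polyC scalerA.
Qed.

Lemma size_jet_var l : (size (jet_var l) <= l.+1)%N.
Proof.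
rewrite jet_varE; apply: leq_trans (size_sum _ _ _) _; apply/bigmax_leqP => r _.
rewrite jet_var_term (leq_trans (size_scale_leq _ _)) // size_polyXn ltnS.
exact: leq_subr.
Qed.

Lemma coef_jet_var l : (jet_var l)`_l = (-1) ^+ l * 'X_ord0.
Proof.
rewrite jet_varE coef_sum big_ord_recl jet_var_term big1 => [|r _].
  by rewrite subn0 bin0 mulr1n coefZ coefXn eqxx mulr1 addr0.
rewrite jet_var_term coefZ coefXn /= /bump /= add1n; case: eqP => [lE|]; last by rewrite mulr0.
have [->|l0] := posnP l; first by rewrite bin_small // mulr0n !mul0r.
have := leq_subr 1 l; rewrite -subSS; move: lE l0; lia.
Qed.

Lemma size_letter_symbol j : (size (letter_symbol j) <= j.+1)%N.
Proof.
rewrite letter_symbolE; apply: leq_trans (size_sum _ _ _) _; apply/bigmax_leqP => l _.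
have [lj|jl] := leqP l j; last by rewrite bin_small // mulr0n mul0r size_poly0.
rewrite -scaler_nat -scalerAl (leq_trans (size_scale_leq _ _)) //.
rewrite (leq_trans (size_polyMleq _ _)) // size_polyXn addSn /=.
by rewrite -[X in (_ <= X.+1)%N](subnK lj) -addnS leq_add2l size_jet_var.
Qed.

(** The Taylor polynomial of [x^(b + 1)] is homogeneous in [x] and [t], so the
   power [t^(b + 1)] only comes with [x^0]; its coefficient is the alternating
   sum of binomial coefficients. *)
Lemma coef_letter_symbol b :
  (letter_symbol b.+1)`_b.+1 = ((-1) ^+ n *+ 'C(b, n)) * 'X_ord0.
Proof.
rewrite letter_symbolE coef_sum -alt_sum_bin mulr_suml; apply: eq_bigr => l _.
have [lb|bl] := leqP l b.+1; last by rewrite bin_small // !mulr0n !mul0r coef0.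
rewrite -scaler_nat -scalerAl coefZ coefXnM ltnNge leq_subr /= subKn //.
by rewrite coef_jet_var mulrnAl mulr_natl.
Qed.

(** The highest letter beyond [n] would contribute the highest power of [t],
   with a nonzero coefficient in characteristic [0]. *)
Lemma letter_symbol_free (q : {poly A}) :
  \sum_(b < size q) q`_b *: letter_symbol b = 0 -> (size q <= n.+1)%N.
Proof.
have [//|] := leqP (size q) n.+1; case qE: (size q) => [|[|b]] // nb.
rewrite big_ord_recr /= => /(congr1 (fun p : K => p`_b.+1)).
rewrite coefD coef_sum big1 => [|i _]; last first.
  rewrite coefZ [(letter_symbol _)`__]nth_default ?mulr0 //.
  by rewrite (leq_trans (size_letter_symbol _)).
rewrite add0r coefZ coef_letter_symbol coef0 => /eqP.
have -> : q`_b.+1 = lead_coef q by rewrite lead_coefE qE.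
rewrite !mulf_eq0 lead_coef_eq0 -size_poly_eq0 qE /= -mulr_natl mulf_eq0 signr_eq0 orbF.
rewrite -(rmorph_nat (@mpolyC n.+1 k)) mpolyC_eq ((pcharf0P k).1 char0).
rewrite eqn0Ngt bin_gt0 -ltnS -ltnS nb /=.
by rewrite -msize_poly_eq0 msizeX.
Qed.

Definition letter_top_symbol d (x : U) : K := top_symbol n jet_const jet_var 'X d x.

Lemma word_top_symbol d s : (size s <= d)%N ->
  letter_top_symbol d (letter_word k s) =
    if size s == d then \prod_(j <- s) letter_symbol j else 0.
Proof.
move=> sd; have -> : letter_word k s = field_word [seq ('X^j : {poly k}) | j <- s].
  by rewrite /field_word big_map.
by rewrite /letter_top_symbol top_symbol_field_word ?size_map // big_map.
Qed.

Lemma top_symbol0 d : letter_top_symbol d 0 = 0.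
Proof. by apply: top_symbol_ker; rewrite rmorph0. Qed.

Lemma top_symbol_filtered d x : filtered d x -> letter_top_symbol d.+1 x = 0.
Proof.
move: x; apply: (lin_span_min (P := fun x => letter_top_symbol d.+1 x = 0)).
  split=> [|a u v u0 v0]; first exact: top_symbol0.
  rewrite /letter_top_symbol top_symbolD top_symbolZ -!/(letter_top_symbol _ _).
  by rewrite u0 v0 mulr0 addr0.
by move=> _ [s sd ->]; rewrite word_top_symbol ?ltn_eqF // ltnW.
Qed.

Lemma top_symbol_sum I (r : seq I) d (F : I -> U) :
  letter_top_symbol d (\sum_(i <- r) F i) = \sum_(i <- r) letter_top_symbol d (F i).
Proof. by apply: (big_morph _ _ (top_symbol0 d)) => x y; apply: top_symbolD. Qed.

Lemma mnm_symbol (m : 'X_{1..n.+1}) :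
  \prod_(j <- mnm_seq m) letter_symbol j = ('X_[m])%:P.
Proof.
rewrite big_flatten big_map /= mpolyXE_id rmorph_prod.
apply: eq_bigr => i _; rewrite big_nseq letter_symbol_small rmorphXn /=.
by rewrite -[LHS]Monoid.iteropE.
Qed.

Lemma top_symbol_normal d (q : {poly A}) : (forall b, q`_b \is d.-homog) ->
  letter_top_symbol d.+1 (normal q) = \sum_(b < size q) q`_b *: letter_symbol b.
Proof.
move=> qh; rewrite top_symbol_sum; apply: eq_bigr => b _.
rewrite ordered_expand mulr_suml top_symbol_sum.
rewrite [in RHS](mpolyE q`_b) scaler_suml big_seq [RHS]big_seq.
apply: eq_bigr => m mq; rewrite -scalerAl /letter_top_symbol top_symbolZ.
rewrite -/(letter_top_symbol _ _) -letter_word1 -letter_word_cat.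
have sz : size (mnm_seq m ++ [:: (b : nat)]) = d.+1.
  by rewrite size_cat addn1 size_mnm_seq (dhomog_mf (qh b) mq).
rewrite word_top_symbol sz // eqxx big_cat big_seq1 mnm_symbol /=.
by rewrite /jet_const mul_polyC mul_polyC scalerA mul_mpolyC.
Qed.
End Independence.

Section KernelInIdeal.
Variables (k : fieldType) (char0 : [pchar k] =i pred0) (n m : nat).
Local Notation U := (env (witt k)).
Variables (L : classical_sets.set U) (Lideal : left_ideal L).
Hypothesis Ldiff : forall N j, (j + m <= N)%N ->
  L (fdiff m (fun i => letter k (N - i) * letter k i) j).
Hypotheses (mn : (m <= 2 * n + 2)%N) (Lker : forall x, L x -> Psi k n x = 0).

(** Induction on the length: the top symbol of an element of the kernel
   vanishes, hence so does its normal form up to shorter words. *)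
Lemma kernel_filtered d x : filtered d x -> Psi k n x = 0 -> L x.
Proof.
have Ls := left_ideal_subspace Lideal.
elim: d x => [|d IH] x dx x0.
  have [c xE] : exists c : k, x = c *: 1.
    move: x dx {x0}; apply: (lin_span_min (P := fun x => exists c : k, x = c *: 1)).
      split=> [|a _ _ [c ->] [c' ->]]; first by exists 0; rewrite scale0r.
      by exists (a * c + c'); rewrite scalerDl scalerA.
    by move=> _ [[|//] _ ->]; exists 1; rewrite scale1r /letter_word big_nil.
  move: x0; rewrite xE linearZ rmorph1 => /eqP; rewrite scaler_eq0 oner_eq0 orbF.
  by move=> /eqP ->; rewrite scale0r; case: Ls.
have [q qh [l Ll yd]] := reducible_filtered Lideal mn char0 Ldiff dx.
suff qd : filtered d (normal q).
  rewrite -(subrK l x); apply: (subspaceD Ls) => //; apply: IH.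
    by rewrite -(subrK (normal q) (x - l)); apply: (subspaceD (filtered_subspace k d)).
  by rewrite rmorphB /= x0 (Lker Ll) subrr.
have q0 : \sum_(b < size q) q`_b *: letter_symbol k n b = 0.
  rewrite -(top_symbol_normal char0 qh).
  have -> : normal q = (x - l) - (x - l - normal q) by rewrite opprB addrC subrK.
  have tB y z : letter_top_symbol n d.+1 (y - z) =
      letter_top_symbol n d.+1 y - letter_top_symbol n d.+1 z.
    rewrite -scaleN1r /letter_top_symbol top_symbolD top_symbolZ; congr +%R.
    by rewrite rmorphN1 mulN1r.
  rewrite tB (top_symbol_filtered char0 n yd) subr0 /letter_top_symbol.
  by rewrite top_symbol_ker // rmorphB /= x0 (Lker Ll) subrr.
have sq := letter_symbol_free char0 q0.
have {}q0 : \sum_(b < n.+1) q`_b * 'X_b = 0.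
  apply: (@polyC_inj {mpoly k[n.+1]}); rewrite -[RHS]q0 rmorph_sum.
  rewrite (big_ord_widen n.+1 (fun b => q`_b *: letter_symbol k n b)) //.
  rewrite [RHS]big_mkcond; apply: eq_bigr => b _; case: ifP => [_|/negbT].
    by rewrite letter_symbol_small rmorphM mul_polyC.
  by rewrite -leqNgt => qb; rewrite nth_default // mul0r.
have -> : normal q = \sum_(b < n.+1) (ordered q`_b * letter k b - ordered (q`_b * 'X_b)).
  rewrite (normal_widen sq) sumrB -[LHS]subr0; congr (_ - _).
  have o0 : ordered (0 : {mpoly k[n.+1]}) = 0 by exact: mmap0.
  by rewrite -(big_morph _ (@orderedD k n) o0) q0.
apply: (subspace_sum (filtered_subspace k d)) => b; exact: orderedM_letter.
Qed.

Lemma kernel_in_ideal x : Psi k n x = 0 -> L x.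
Proof. by have [d] := filtered_exhaustive x; apply: kernel_filtered. Qed.
End KernelInIdeal.

(** * Differentiators vanish under the orbit homomorphism *)
Section DifferenceCalculus.
Variables (k : fieldType) (V : lmodType k).
Implicit Types x y : nat -> V.

Lemma eq_fdiff m x y j : (forall i, (j <= i <= j + m)%N -> x i = y i) ->
  fdiff m x j = fdiff m y j.
Proof.
move=> xy; apply: eq_bigr => i _; rewrite xy // leq_addr leq_add2l.
by rewrite -ltnS ltn_ord.
Qed.

Lemma fdiffB m x y j : fdiff m (fun i => x i - y i) j = fdiff m x j - fdiff m y j.
Proof. by rewrite /fdiff -sumrB; apply: eq_bigr => i _; rewrite scalerBr. Qed.

Lemma fdiff_linear (V' : lmodType k) (f : {linear V -> V'}) m x j :
  f (fdiff m x j) = fdiff m (f \o x) j.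
Proof. by rewrite linear_sum; apply: eq_bigr => i _; rewrite linearZ. Qed.

Lemma fdiffD m x y j : fdiff m (fun i => x i + y i) j = fdiff m x j + fdiff m y j.
Proof. by rewrite /fdiff -big_split; apply: eq_bigr => i _; rewrite scalerDr. Qed.

Lemma fdiff_sum I (r : seq I) m (F : I -> nat -> V) j :
  fdiff m (fun i => \sum_(a <- r) F a i) j = \sum_(a <- r) fdiff m (F a) j.
Proof. by rewrite exchange_big; apply: eq_bigr => i _; rewrite scaler_sumr. Qed.

Lemma fdiff0_eq0 m x j : (forall i, x i = 0) -> fdiff m x j = 0.
Proof. by move=> x0; rewrite /fdiff big1 // => i _; rewrite x0 scaler0. Qed.
End DifferenceCalculus.

Section DifferentiatorInKernel.
Variable k : fieldType.

Lemma nderivnXM (f : {poly k}) l : ('X * f)^`N(l) =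
  'X * f^`N(l) + (if l is l'.+1 then f^`N(l') else 0).
Proof.
rewrite ['X * f]mulrC; case: l => [|l]; first by rewrite !nderivn0 addr0 mulrC.
by rewrite -[f * 'X]addr0 -polyC0 nderivnMXaddC addrC mulrC.
Qed.

(** Each step of differencing lowers the order of one of the two derivatives
   by one, since [(t f)^(l) = t f^(l) + f^(l - 1)] for divided derivatives. *)
Lemma fdiff_nderivn m l l' N j : (l + l' < m)%N -> (j + m <= N)%N ->
  fdiff m (fun i => ('X^(N - i))^`N(l) * ('X^i)^`N(l')) j = 0 :> {poly k}.
Proof.
elim: m l l' N => [|m IH] l l' [|N] // llm jmN; first by rewrite addnS in jmN.
rewrite fdiffS.
pose F a b i : {poly k} := ('X^(N - i))^`N(a) * ('X^i)^`N(b).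
rewrite (@eq_fdiff _ _ _ _ (fun i => (if l is a.+1 then F a l' i else 0)
    - (if l' is b.+1 then F l b i else 0))); last first.
  move=> i /andP[_ ijm]; rewrite subSS subSn; last by lia.
  rewrite !exprS !nderivnXM mulrDl mulrDr opprD addrACA mulrCA mulrA subrr add0r.
  by rewrite /F; congr (_ - _); [case: (l) | case: (l')] => *; rewrite ?mul0r ?mulr0.
rewrite addnS ltnS in jmN; rewrite fdiffB.
have F0 a b : (a + b < m)%N -> fdiff m (F a b) j = 0 by move=> ?; apply: IH.
have z0 : fdiff m (fun=> 0 : {poly k}) j = 0 by apply: fdiff0_eq0.
case: l llm => [|l] llm; case: l' llm => [|l'] llm; rewrite ?z0 ?F0 ?subrr //; lia.
Qed.

Variable n : nat.
Local Notation T := (orbit_alg k n).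
Local Notation P f := (tens (weyl_poly f) (1 : env (gquot k n)) : T).

Lemma orbit_polyM (f g : {poly k}) : P (f * g) = P f * P g.
Proof. by rewrite [RHS]tensM -rmorphM mulr1. Qed.

Fact orbit_poly_is_linear : linear (fun f : {poly k} => P f).
Proof. by move=> a f g; rewrite weyl_poly_linear tensDl tensZl. Qed.
Definition orbit_poly (f : {poly k}) : T := P f.
HB.instance Definition _ := GRing.isLinear.Build k {poly k} T _ orbit_poly
  orbit_poly_is_linear.

(** The factor of [psi f] multiplying the [l]-th divided derivative of [f]. *)
Definition jet_coef (l : nat) : T :=
  if l is i.+1 then tens (1 : weyl k) (env_gen (gquot_v k n i))
  else tens (weyl_d k) (1 : env (gquot k n)).

Lemma psi_jet (f : {poly k}) :
  psi k n f = \sum_(l < n.+1) orbit_poly f^`N(l) * jet_coef l.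
Proof. by rewrite psiE big_ord_recl nderivn0. Qed.

Lemma jet_coef_poly l (f : {poly k}) : jet_coef l * orbit_poly f =
  orbit_poly f * jet_coef l + (if l is 0 then orbit_poly f^`() else 0).
Proof.
case: l => [|l]; last by rewrite addr0 [LHS]tensM [RHS]tensM !mulr1 !mul1r.
rewrite [LHS]tensM weyl_d_poly tensDl mulr1; congr +%R.
by rewrite [RHS]tensM mulr1.
Qed.

(** The second sum comes from moving [d/dt], in the first factor, past the
   coefficients of the second. *)
Lemma psiM (f g : {poly k}) : psi k n f * psi k n g =
  \sum_(l < n.+1) \sum_(l' < n.+1)
     orbit_poly (f^`N(l) * g^`N(l')) * (jet_coef l * jet_coef l')
  + \sum_(l' < n.+1) orbit_poly (f^`N(0) * g^`N(l'.+1)) * jet_coef l' *+ l'.+1.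
Proof.
rewrite !psi_jet mulr_suml.
pose G l' := orbit_poly (f^`N(0) * g^`N(l'.+1)) * jet_coef l' *+ l'.+1.
have E (l : 'I_n.+1) :
    orbit_poly f^`N(l) * jet_coef l * (\sum_(l' < n.+1) orbit_poly g^`N(l') * jet_coef l')
    = \sum_(l' < n.+1) orbit_poly (f^`N(l) * g^`N(l')) * (jet_coef l * jet_coef l')
    + if l == ord0 then \sum_(l' < n.+1) G l' else 0.
  rewrite mulr_sumr; have -> : (if l == ord0 then \sum_(l' < n.+1) G l' else 0)
      = \sum_(l' < n.+1) if l == ord0 then G l' else 0.
    by case: (l == ord0); rewrite // big1.
  rewrite -big_split; apply: eq_bigr => l' _ /=.
  rewrite !mulrA -(mulrA (orbit_poly _)) jet_coef_poly mulrDr mulrDl.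
  rewrite /G /orbit_poly !orbit_polyM -/(orbit_poly _) !mulrA; congr +%R.
  case: (unliftP ord0 l) => [i|] ->; first by rewrite mulr0 mul0r.
  rewrite /= deriv_nderivn -/(orbit_poly _) raddfMn /= mulrnAr mulrnAl.
  by rewrite /orbit_poly.
rewrite (eq_bigr _ (fun l _ => E l)) big_split /=; congr +%R.
by rewrite -big_mkcond big_pred1_eq.
Qed.

(** The divided derivatives occurring in [psiM] have total order at most [2n],
   or [n + 1] in the second sum, which is also at most [2n]. *)
Lemma differentiator_orbit m N j : (0 < n)%N -> (2 * n < m)%N -> (j + m <= N)%N ->
  Psi k n (fdiff m (fun i => letter k (N - i) * letter k i) j) = 0.
Proof.
move=> n0 nm jmN; rewrite (fdiff_linear (Psi k n)).
rewrite (@eq_fdiff _ _ _ _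
  (fun i => psi k n ('X^(N - i) : {poly k}) * psi k n ('X^i : {poly k}))).
  2: move=> i _; rewrite /= rmorphM /=.
  2: by rewrite [Psi k n (letter _ _)]env_liftE [Psi k n (letter _ i)]env_liftE.
rewrite (@eq_fdiff _ _ _ _ _ _ (fun i _ => psiM _ _)) fdiffD.
have D0 l l' w : (l + l' < m)%N -> fdiff m (fun i =>
   orbit_poly (('X^(N - i))^`N(l) * ('X^i)^`N(l')) * w) j = 0.
  move=> ll; transitivity (orbit_poly (fdiff m (fun i =>
     ('X^(N - i))^`N(l) * ('X^i)^`N(l')) j) * w); last first.
    by rewrite fdiff_nderivn // raddf0 mul0r.
  rewrite fdiff_linear mulr_suml; apply: eq_bigr => i _.
  by rewrite -scalerAl.
rewrite fdiff_sum big1 => [|l _]; last first.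
  rewrite fdiff_sum big1 // => l' _; apply: D0.
  by have := ltn_ord l; have := ltn_ord l'; lia.
rewrite add0r fdiff_sum big1 // => l' _.
rewrite (@eq_fdiff _ _ _ _ (fun i => orbit_poly (('X^(N - i))^`N(0) * ('X^i)^`N(l'.+1))
   * (jet_coef l' *+ l'.+1))) ?D0 //; first by have := ltn_ord l'; lia.
by move=> i _; rewrite mulrnAr.
Qed.
End DifferentiatorInKernel.

(** * Quadratic elements as polynomials in two variables *)
Section QuadraticElements.
Variable k : fieldType.
Local Notation U := (env (witt k)).
Local Notation B := {poly {poly k}}.
Implicit Types (f g : {poly k}) (F G : B).

(** The linear map sending [a(t1) b(t2)] to the product of [a d/dt] and
   [b d/dt]; see [quad_tens].  The outer variable of [B] is [t1]. *)
Definition quad F : U := \sum_(i < size F) letter k i * env_gen (F`_i : witt k).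
Definition bconst (a : k) : B := (a%:P)%:P.
HB.instance Definition _ := GRing.RMorphism.copy bconst (polyC \o @polyC k).

Lemma quad_widen F N : (size F <= N)%N ->
  quad F = \sum_(i < N) letter k i * env_gen (F`_i : witt k).
Proof.
move=> FN; rewrite /quad (big_ord_widen N (fun i => letter k i * env_gen (F`_i : witt k))) //.
rewrite big_mkcond; apply: eq_bigr => b _; case: ifP => // /negbT.
by rewrite -leqNgt => qb; rewrite nth_default // [env_gen _]raddf0 mulr0.
Qed.

Lemma quadP a F G : quad (bconst a * F + G) = a *: quad F + quad G.
Proof.
pose N := maxn (size F) (size G).
have FN : (size F <= N)%N by rewrite leq_maxl.
have GN : (size G <= N)%N by rewrite leq_maxr.
rewrite (quad_widen FN) (quad_widen GN) (@quad_widen _ N).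
  rewrite scaler_sumr -big_split /=; apply: eq_bigr => i _.
  by rewrite coefD mul_polyC coefZ mul_polyC [env_gen _]linearP mulrDr scalerAr.
rewrite (leq_trans (size_polyD _ _)) // geq_max GN andbT.
by rewrite mul_polyC (leq_trans (size_scale_leq _ _)).
Qed.

Lemma quadD F G : quad (F + G) = quad F + quad G.
Proof. by have := quadP 1 F G; rewrite rmorph1 mul1r scale1r. Qed.
Lemma quad0 : quad 0 = 0.
Proof. by rewrite /quad size_poly0 big_ord0. Qed.
Lemma quadZ a F : quad (bconst a * F) = a *: quad F.
Proof. by rewrite -[bconst a * F]addr0 quadP quad0 addr0. Qed.
Lemma quadN F : quad (- F) = - quad F.
Proof. by rewrite -mulN1r -(rmorphN1 bconst) quadZ scaleN1r. Qed.

Lemma quad_tens f g : quad (f^:P * g%:P) = env_gen (f : witt k) * env_gen (g : witt k).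
Proof.
rewrite (@quad_widen _ (size f)); last first.
  by rewrite mulrC mul_polyC (leq_trans (size_scale_leq _ _)) // size_map_polyC.
rewrite -[in RHS](coefK f) poly_def [X in _ = X * _]raddf_sum mulr_suml.
apply: eq_bigr => i _; rewrite coefMC coef_map /= mul_polyC.
by rewrite [X in _ * X = _]linearZ -scalerAr [X in _ = X * _]linearZ -scalerAl.
Qed.

Lemma bipoly_ind (P : B -> Prop) : P 0 -> (forall F G, P F -> P G -> P (F + G)) ->
  (forall i g, P (('X^i)^:P * g%:P)) -> forall F, P F.
Proof.
move=> P0 PD Pm F; rewrite -(coefK F) poly_def.
apply: (big_ind P) => // i _; rewrite -mul_polyC mulrC.
by rewrite (_ : 'X^i = ('X^i)^:P) // map_polyXn.
Qed.

Definition der1 F : B := F^`().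
Definition der2 F : B := map_poly (@deriv k) F.

Lemma der2D F G : der2 (F + G) = der2 F + der2 G.
Proof. exact: raddfD. Qed.
Lemma der2M F G : der2 (F * G) = der2 F * G + F * der2 G.
Proof.
apply/polyP => i; rewrite coefD !coefM coef_map /= coefM raddf_sum -big_split /=.
by apply: eq_bigr => j _; rewrite derivM !coef_map.
Qed.
Lemma der2C g : der2 g%:P = (g^`())%:P.
Proof. by rewrite /der2 map_polyC. Qed.
Lemma der2_polyC f : der2 f^:P = 0.
Proof. by apply/polyP => i; rewrite coef0 !coef_map /= derivC. Qed.
Lemma der1_polyC f : der1 f^:P = (f^`())^:P.
Proof. exact: deriv_map. Qed.

(** The action of [f d/dt] on [W (x) W], written on polynomials in two
   variables; see [quad_adj]. *)
Definition adj f F : B :=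
  f^:P * der1 F + f%:P * der2 F - ((f^`())^:P + (f^`())%:P) * F.

Lemma adjD f F G : adj f (F + G) = adj f F + adj f G.
Proof. by rewrite /adj /der1 derivD der2D; ring. Qed.

Lemma adjZ f a F : adj f (bconst a * F) = bconst a * adj f F.
Proof. by rewrite /adj /der1 derivM der2M der2C !derivC; ring. Qed.

(** The commutator with [f d/dt] is a derivation, so it acts on each of the two
   factors. *)
Lemma quad_adj f F :
  env_gen (f : witt k) * quad F - quad F * env_gen (f : witt k) = quad (adj f F).
Proof.
move: F; apply: bipoly_ind => [|F G IHF IHG|i g].
- by rewrite quad0 mulr0 mul0r subrr /adj /der1 deriv0 /der2 raddf0 !mulr0 subr0 addr0 quad0.
- by rewrite adjD (quadD F) (quadD (adj f F)) mulrDr mulrDl opprD [LHS]addrACA IHF IHG.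
rewrite quad_tens; set x := 'X^i.
have -> : adj f (x^:P * g%:P) = (witt_lie f x)^:P * g%:P + x^:P * (witt_lie f g)%:P.
  rewrite /adj /der1 derivM der2M derivC der2_polyC der2C.
  rewrite -[(x^:P)^`()]/(der1 _) der1_polyC /witt_lie.
  by rewrite !(rmorphB, rmorphM) /=; ring.
rewrite quadD !quad_tens [X in _ = X * _ + _]env_gen_lie [X in _ = _ + _ * X]env_gen_lie.
by rewrite mulrBl mulrBr !mulrA addrA subrK.
Qed.

Lemma quad_swap F : quad F - quad (swapXY F) =
  env_gen ((der2 F - der1 F).['X] : witt k).
Proof.
move: F; apply: bipoly_ind => [|F G IHF IHG|i g].
- by rewrite raddf0 quad0 subrr /der1 deriv0 /der2 raddf0 subr0 horner0 [RHS]raddf0.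
- rewrite raddfD /= !quadD opprD [LHS]addrACA IHF IHG -[LHS]raddfD; congr env_gen.
  rewrite -hornerD der2D /der1 derivD; congr (_.[_]); ring.
set x := 'X^i; rewrite rmorphM /= swapXY_polyC swapXY_map_polyC.
rewrite (mulrC x%:P) !quad_tens -env_gen_lie; congr env_gen.
rewrite der2M /der1 derivM derivC der2_polyC der2C -[(x^:P)^`()]/(der1 _) der1_polyC.
rewrite mul0r add0r mulr0 addr0 hornerD hornerN !hornerM !hornerC.
have comp p : (p^:P).['X] = p :> {poly k} by exact: comp_polyXr.
by rewrite !comp.
Qed.

Local Notation T1 := ('X : B).
Local Notation T2 := (('X : {poly k})%:P : B).
Definition tsum : B := T1 + T2.
Definition tdiff : B := T1 - T2.

Lemma swap_tsum : swapXY tsum = tsum.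
Proof. by rewrite /tsum raddfD /= swapXY_X swapXY_Y addrC. Qed.
Lemma swap_tdiff : swapXY tdiff = - tdiff.
Proof. by rewrite /tdiff raddfB /= swapXY_X swapXY_Y opprB. Qed.

Lemma der1_tsum : der1 tsum = 1.
Proof. by rewrite /der1 derivD derivX derivC addr0. Qed.
Lemma der2_T1 : der2 T1 = 0.
Proof. by rewrite -(map_polyX (@polyC k)) der2_polyC. Qed.
Lemma der2_tsum : der2 tsum = 1.
Proof. by rewrite der2D der2C derivX der2_T1 add0r. Qed.
Lemma der1_tdiff : der1 tdiff = 1.
Proof. by rewrite /der1 derivB derivX derivC subr0. Qed.
Lemma der2_tdiff : der2 tdiff = -1.
Proof. by rewrite /der2 raddfB /= -!/(der2 _) der2C derivX der2_T1 add0r. Qed.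

(** By [quad_swap], exchanging the factors only sees a polynomial to first order
   along the diagonal, where [tdiff] vanishes. *)
Lemma quad_swap_tdiff2 F : quad (swapXY (tdiff ^+ 2 * F)) = quad (tdiff ^+ 2 * F).
Proof.
apply/eqP; rewrite -subr_eq0 -opprB quad_swap oppr_eq0.
have -> : der2 (tdiff ^+ 2 * F) - der1 (tdiff ^+ 2 * F) =
    tdiff * (tdiff * (der2 F - der1 F) - 4 * F).
  have d1 := der1_tdiff; rewrite /der1 in d1.
  by rewrite expr2 !der2M /der1 !derivM d1 der2_tdiff; ring.
rewrite hornerM (_ : tdiff.['X] = 0) ?mul0r ?[env_gen _]raddf0 //.
by rewrite /tdiff hornerD hornerX hornerN hornerC subrr.
Qed.

Lemma quad_antisym F : [pchar k] =i pred0 ->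
  swapXY (tdiff ^+ 2 * F) = - (tdiff ^+ 2 * F) -> quad (tdiff ^+ 2 * F) = 0.
Proof.
move=> char0 sF; have := quad_swap_tdiff2 F; rewrite sF quadN => /eqP.
rewrite eq_sym -addr_eq0 -mulr2n -scaler_nat scaler_eq0.
by rewrite ((pcharf0P k).1 char0) => /eqP.
Qed.

(** The binomial expansion of [(t1 - t2)^m]. *)
Lemma fdiff_quad m N j : (j + m <= N)%N ->
  fdiff m (fun i => letter k (N - i) * letter k i) j
  = quad (tdiff ^+ m * (T1 ^+ (N - j - m) * T2 ^+ j)).
Proof.
move=> jmN; rewrite /tdiff exprBn mulr_suml (big_morph _ quadD quad0).
apply: eq_bigr => i _; have im : (i <= m)%N by rewrite -ltnS.
rewrite -quad_tens -quadZ; congr quad.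
have -> : ('X^(N - (j + i)))^:P = T1 ^+ (N - j - m) * T1 ^+ (m - i).
  by rewrite -exprD map_polyXn; congr (_ ^+ _); lia.
rewrite polyC_exp exprD rmorphMn rmorphXn rmorphN1 /=.
rewrite -mulr_natr -[X in _ = X * _]mulr_natr; ring.
Qed.
End QuadraticElements.

(** * The adjoint action in the coordinates u and v *)
Section Generation.
Variables (k : fieldType) (char0 : [pchar k] =i pred0).
Local Notation U := (env (witt k)).
Local Notation B := {poly {poly k}}.
Local Notation T1 := ('X : B).
Local Notation T2 := (('X : {poly k})%:P : B).
Local Notation u := (tsum k).
Local Notation v := (tdiff k).
Implicit Types (f g : {poly k}) (F G : B).

Lemma der1X F i : der1 (F ^+ i) = F ^+ i.-1 * der1 F *+ i.
Proof. by rewrite /der1 deriv_exp mulrC. Qed.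

Lemma der2X F i : der2 (F ^+ i) = F ^+ i.-1 * der2 F *+ i.
Proof.
elim: i => [|i IH]; first by rewrite mulr0n expr0 der2C derivC.
rewrite exprS der2M IH mulrS mulrnAr mulrA; congr (_ + _); first by rewrite mulrC.
by case: i {IH} => [|i]; rewrite ?mulr0n //= exprS.
Qed.

Lemma der1_uv i j :
  der1 (u ^+ i * v ^+ j) = u ^+ i.-1 * v ^+ j *+ i + u ^+ i * v ^+ j.-1 *+ j.
Proof.
rewrite /der1 derivM -!/(der1 _) !der1X der1_tsum der1_tdiff !mulr1.
by rewrite mulrnAl mulrnAr.
Qed.

Lemma der2_uv i j :
  der2 (u ^+ i * v ^+ j) = u ^+ i.-1 * v ^+ j *+ i - u ^+ i * v ^+ j.-1 *+ j.
Proof.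
rewrite der2M !der2X der2_tsum der2_tdiff !mulr1 mulrN1 mulNrn mulrN.
by rewrite mulrnAl mulrnAr.
Qed.

Lemma adj_e_minus1 i j : adj 1 (u ^+ i * v ^+ j) = u ^+ i.-1 * v ^+ j *+ (2 * i).
Proof.
rewrite /adj derivC -polyC0 !rmorph0 addr0 mul0r subr0 rmorph1 !mul1r.
by rewrite der1_uv der2_uv addrACA subrr addr0 -mulrnDr addnn mul2n.
Qed.

(** In the coordinates [u] and [v], [t^2 d/dt] acts by
   [(u^2 + v^2)/2 d/du + u v d/dv - 2 u]. *)
Lemma adj_e1 i j : (0 < j)%N -> 2 * adj 'X^2 (u ^+ i * v ^+ j) =
  ((i + 2 * j)%:R - 4) * (u ^+ i.+1 * v ^+ j) + i%:R * (u ^+ i.-1 * v ^+ j.+2).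
Proof.
case: j => // j _; rewrite /adj der1_uv der2_uv derivXn /= expr1.
rewrite map_polyXn rmorphXn rmorphMn [in X in _ - X]rmorphMn /= map_polyX.
case: i => [|i]; rewrite /= !exprS; move: (u ^+ _) (v ^+ _) => a b; rewrite /tsum /tdiff.
  by ring.
by ring.
Qed.

(** In the coordinates [u] and [v], [t^3 d/dt] acts by
   [(u^3 + 3 u v^2)/4 d/du + (3 u^2 v + v^3)/4 d/dv - 3 (u^2 + v^2)/2]. *)
Lemma adj_e2 j : (0 < j)%N -> 4 * adj 'X^3 (v ^+ j) =
  ((3 * j)%:R - 6) * (u ^+ 2 * v ^+ j) + (j%:R - 6) * v ^+ j.+2.
Proof.
case: j => // j _; have := der1_uv 0 j.+1; have := der2_uv 0 j.+1.
rewrite !mul1r /= !mulr0n sub0r add0r => d2 d1.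
rewrite /adj d1 d2 derivXn /= map_polyXn rmorphXn rmorphMn [in X in _ - X]rmorphMn /=.
rewrite map_polyXn rmorphXn /=.
rewrite /= !exprS; move: (v ^+ _) => b; rewrite /tsum /tdiff.
ring.
Qed.

Section Ideal.
Variables (I : classical_sets.set U) (Iideal : two_sided_ideal I).

Lemma ideal_subspace : subspace I.
Proof. by apply: left_ideal_subspace; case: Iideal. Qed.

Definition quad_in F : Prop := I (quad F).

Lemma quad_inD F G : quad_in F -> quad_in G -> quad_in (F + G).
Proof. by rewrite /quad_in quadD; apply: (subspaceD ideal_subspace). Qed.
Lemma quad_inZ a F : quad_in F -> quad_in (bconst a * F).
Proof. by rewrite /quad_in quadZ; apply: (subspaceZ ideal_subspace). Qed.
Lemma quad_inB F G : quad_in F -> quad_in G -> quad_in (F - G).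
Proof.
move=> IF IG.
have e : bconst (-1) = -1 :> B by exact: rmorphN1.
have -> : - G = bconst (-1) * G by rewrite e mulN1r.
by apply: quad_inD => //; apply: quad_inZ.
Qed.
Lemma quad_in_unscale a F : a != 0 -> quad_in (bconst a * F) -> quad_in F.
Proof.
move=> a0 /(quad_inZ a^-1); by rewrite mulrA -rmorphM mulVf // rmorph1 mul1r.
Qed.
Lemma quad_in_adj f F : quad_in F -> quad_in (adj f F).
Proof.
case: Iideal => -[_ _ IM] MI IF; rewrite /quad_in -quad_adj.
by apply: (subspaceB ideal_subspace); [apply: IM | apply: MI].
Qed.
Lemma quad_in_natl (i : nat) F : quad_in F -> quad_in (i%:R * F).
Proof.
move=> IF; have -> : i%:R * F = bconst i%:R * F by rewrite rmorph_nat.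
exact: quad_inZ.
Qed.

(** These polynomials represent [0]: they are antisymmetric and divisible by
   [v^2]. *)
Lemma quad_in_odd i j : odd j -> (3 <= j)%N -> quad_in (u ^+ i * v ^+ j).
Proof.
move=> jodd j3; rewrite /quad_in.
have -> : u ^+ i * v ^+ j = v ^+ 2 * (u ^+ i * v ^+ (j - 2)).
  by rewrite mulrCA -exprD subnKC // ltnW.
rewrite quad_antisym //; first by case: ideal_subspace.
have -> : v ^+ 2 * (u ^+ i * v ^+ (j - 2)) = u ^+ i * v ^+ j.
  by rewrite mulrCA -exprD subnKC // ltnW.
by rewrite rmorphM !rmorphXn /= swap_tsum swap_tdiff exprNn -signr_odd jodd mulN1r mulrN.
Qed.

Lemma bconst_natB (a b : nat) : bconst (a%:R - b%:R) = a%:R - b%:R :> B.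
Proof.
have scn i : bconst i%:R = i%:R :> B by exact: rmorph_nat.
by rewrite -!scn; apply: rmorphB.
Qed.

Lemma natr_neq0 (i : nat) : (0 < i)%N -> i%:R != 0 :> k.
Proof. by move=> i0; rewrite ((pcharf0P k).1 char0) -lt0n. Qed.

(** The actions of [t^2 d/dt] on [u v^j] and of [t^3 d/dt] on [v^j] give two
   combinations of [u^2 v^j] and [v^(j + 2)].  Their determinant is a multiple
   of [j^2 - 9 j + 12], which has no integer root. *)
Lemma quad_in_next j : (4 <= j)%N -> quad_in (v ^+ j) -> quad_in (v ^+ j.+2).
Proof.
move=> j4 Ij; have j0 : (0 < j)%N by apply: leq_trans j4.
have Iuj : quad_in (u * v ^+ j).
  apply: (@quad_in_unscale (2 * (j - 2))%:R); first by apply: natr_neq0; lia.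
  have /(quad_in_natl 2) := quad_in_adj 'X^2 Ij.
  have := adj_e1 0 j0; rewrite !mul1r mul0r addr0 expr1 => ->.
  congr (quad_in (_ * _)); rewrite rmorph_nat natrM natrB ?(leq_trans _ j4) //.
  by rewrite add0n natrM; ring.
have /(quad_in_natl 2) := quad_in_adj 'X^2 Iuj.
have := adj_e1 1 j0; rewrite expr1 mul1r => -> I1; rewrite mul1r in I1.
have := quad_in_natl 4 (quad_in_adj 'X^3 Ij); rewrite (adj_e2 j0) => I2.
(* [j^2 + 12 = 9 j] fails for [j >= 9] by size, and below [9] by inspection. *)
have c0 : (j ^ 2 + 12)%:R - (9 * j)%:R != 0 :> k.
  apply/eqP => /eqP; rewrite subr_eq0 => /eqP /(natr_inj char0).
  have [j9|j9] := leqP 9 j.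
    by have : (9 * j <= j ^ 2)%N by [rewrite expnS expn1 leq_mul2r j9 orbT]; lia.
  by move: j j9 {j4 j0 Ij Iuj I1 I2} => [|[|[|[|[|[|[|[|[|]]]]]]]]].
apply: (quad_in_unscale c0); apply: (@quad_in_unscale 2); first exact: (natr_neq0 (i := 2)).
have I3 := quad_inZ ((2 * j)%:R - 3) I2; have I4 := quad_inZ ((3 * j)%:R - 6) I1.
have := quad_inB I3 I4; congr quad_in.
have sc2 : bconst 2 = 2 :> B by exact: rmorph_nat.
rewrite !bconst_natB sc2 !natrM !natrD !natrX; ring.
Qed.

(** By [adj_e1], the element [u^(i + 1) v^j] is obtained from [u^i v^j] and
   [u^(i - 1) v^(j + 2)]; hence an induction on [i] for all exponents of [v]
   simultaneously, keeping two consecutive values of [i]. *)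
Lemma quad_in_powers i j r : (4 <= j)%N -> quad_in (v ^+ j) ->
  quad_in (u ^+ i * v ^+ (j + 2 * r)).
Proof.
move=> j4 Ij; have Ir r' : quad_in (v ^+ (j + 2 * r')).
  elim: r' => [|r' IH]; first by rewrite muln0 addn0.
  have -> : (j + 2 * r'.+1 = (j + 2 * r').+2)%N by lia.
  by apply: quad_in_next IH; lia.
suff [] : (forall r, quad_in (u ^+ i * v ^+ (j + 2 * r))) /\
          (forall r, quad_in (u ^+ i.+1 * v ^+ (j + 2 * r))) by [].
have step i' : (forall r, quad_in (u ^+ i' * v ^+ (j + 2 * r))) ->
    (forall r, quad_in (u ^+ i'.-1 * v ^+ (j + 2 * r))) ->
    forall r, quad_in (u ^+ i'.+1 * v ^+ (j + 2 * r)).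
  move=> I0 I1 r'; set J := (j + 2 * r')%N; have J0 : (0 < J)%N by rewrite /J; lia.
  apply: (@quad_in_unscale (i' + 2 * J - 4)%:R); first by apply: natr_neq0; rewrite /J; lia.
  have := quad_inB (quad_in_natl 2 (quad_in_adj 'X^2 (I0 r'))) (quad_in_natl i' (I1 r'.+1)).
  rewrite adj_e1 // -/J (_ : (j + 2 * r'.+1 = J.+2)%N) ?addrK; last by rewrite /J; lia.
  by congr (quad_in (_ * _)); rewrite natrB ?bconst_natB //; rewrite /J; lia.
elim: i {r} => [|i [IH0 IH1]].
  have I0 r : quad_in (u ^+ 0 * v ^+ (j + 2 * r)) by rewrite expr0 mul1r.
  by split=> // r; apply: step.
by split=> //; apply: step.
Qed.

(** Up to a factor, [d/dt] acts as the derivative in [u]; applying it [N] times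
   leaves only the term of highest degree in [u]. *)
Lemma quad_in_lower N (c : nat -> k) j : c 0%N != 0 ->
  quad_in (\sum_(i < N.+1) bconst (c i) * (u ^+ (N - i) * v ^+ (j + i))) -> quad_in (v ^+ j).
Proof.
elim: N c => [|N IH] c c0 Ic.
  by apply: (quad_in_unscale c0); move: Ic; rewrite big_ord1 addn0 expr0 mul1r.
apply: (IH (fun i => c i * (2 * (N.+1 - i))%:R)).
  by rewrite mulf_neq0 // natr_neq0.
have := quad_in_adj 1 Ic; congr quad_in.
have adj0 : adj 1 0 = 0 :> B.
  by have := adjZ 1 0 (0 : B); rewrite mulr0 => ->; rewrite rmorph0 mul0r.
rewrite (big_morph _ (adjD 1) adj0) big_ord_recr /= subnn adjZ adj_e_minus1.
rewrite muln0 mulr0n mulr0 addr0; apply: eq_bigr => i _.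
rewrite adjZ adj_e_minus1.
have -> : (N.+1 - i).-1 = (N - i)%N by lia.
have -> : bconst (c i * (2 * (N.+1 - i))%:R) = bconst (c i) * (2 * (N.+1 - i))%:R :> B.
  by rewrite -[X in _ = _ * X](rmorph_nat (@bconst k)); apply: rmorphM.
by rewrite -mulrA mulr_natl.
Qed.

(** Only the two leading coefficients matter: the first one is used when [m] is
   even, and the second one when [m] is odd. *)
Lemma expand_uv a b : exists c : nat -> k, [/\ c 0%N = 1, c 1%N = a%:R - b%:R &
  (u + v) ^+ a * (u - v) ^+ b
  = \sum_(i < (a + b).+1) bconst (c i) * (u ^+ (a + b - i) * v ^+ i)].
Proof.
suff [c [c0 c1 _ E]] : exists c : nat -> k, [/\ c 0%N = 1, c 1%N = a%:R - b%:R,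
    forall i, (a + b < i)%N -> c i = 0 &
  (u + v) ^+ a * (u - v) ^+ b
  = \sum_(i < (a + b).+1) bconst (c i) * (u ^+ (a + b - i) * v ^+ i)] by exists c.
have step N c e F : (forall i, (N < i)%N -> c i = 0) ->
    F = \sum_(i < N.+1) bconst (c i) * (u ^+ (N - i) * v ^+ i) ->
    exists c' : nat -> k, [/\ c' 0%N = c 0%N, c' 1%N = c 1%N + e * c 0%N,
      forall i, (N.+1 < i)%N -> c' i = 0 &
      (u + bconst e * v) * F = \sum_(i < N.+2) bconst (c' i) * (u ^+ (N.+1 - i) * v ^+ i)].
  move=> cN ->; exists (fun i => c i + (if i is i'.+1 then e * c i' else 0)).
  split=> [||[//|i] iN|]; rewrite ?addr0 //.
    by rewrite !cN ?mulr0 ?addr0 // ltnW.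
  rewrite mulrDl.
  have sD x y : bconst (x + y) = bconst x + bconst y :> B by exact: rmorphD.
  have sM x y : bconst (x * y) = bconst x * bconst y :> B by exact: rmorphM.
  have s0 : bconst 0 = 0 :> B by exact: rmorph0.
  under [RHS]eq_bigr do rewrite sD mulrDl.
  rewrite big_split /=; congr (_ + _).
    rewrite [RHS]big_ord_recr /= (cN N.+1) // s0 mul0r addr0 mulr_sumr; apply: eq_bigr => i _.
    have iN : (i <= N)%N by rewrite -ltnS.
    rewrite (subSn iN) exprS; move: (u ^+ _) (v ^+ _) => x y; ring.
  rewrite [RHS]big_ord_recl /= s0 mul0r add0r mulr_sumr; apply: eq_bigr => i _.
  rewrite sM /bump /= add1n subSS exprS; move: (u ^+ _) (v ^+ _) => x y; ring.
have s1 : bconst 1 = 1 :> B by exact: rmorph1.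
have sN1 : bconst (-1) = -1 :> B by exact: rmorphN1.
elim: a => [|a [c [c0 c1 cN E]]].
  elim: b => [|b [c [c0 c1 cN E]]].
    exists (fun i => (i == 0%N)%:R); split=> //; first by rewrite subrr.
      by move=> [].
    by rewrite big_ord1 !expr0 s1 !mulr1.
  have [c' [c'0 c'1 c'N E']] := step _ _ (-1) _ cN E.
  exists c'; rewrite -E' c'0 c'1 c0 c1; split=> //.
    by rewrite mulr1 -addrA -opprD -mulrSr.
  by rewrite sN1 mulN1r exprS; ring.
have [c' [c'0 c'1 c'N E']] := step _ _ 1 _ cN E.
exists c'; rewrite addSn -E' c'0 c'1 c0 c1; split=> //.
  by rewrite mulr1 addrAC -mulrSr.
by rewrite s1 mul1r exprS mulrA.
Qed.
End Ideal.
End Generation.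

(** * One nonzero differentiator generates all of them *)
Section AllDifferentiators.
Variables (k : fieldType) (char0 : [pchar k] =i pred0).
Local Notation U := (env (witt k)).
Local Notation B := {poly {poly k}}.
Local Notation T1 := ('X : B).
Local Notation T2 := (('X : {poly k})%:P : B).
Local Notation u := (tsum k).
Local Notation v := (tdiff k).
Variables (I : classical_sets.set U) (Iideal : two_sided_ideal I).
Variables (n : nat) (n_gt0 : (0 < n)%N).

Lemma quad_in_uv i j : quad_in I (v ^+ (2 * n + 2)) -> (2 * n + 1 <= j)%N ->
  quad_in I (u ^+ i * v ^+ j).
Proof.
move=> IM jn; have [jodd|jeven] := boolP (odd j).
  by apply: (quad_in_odd char0 Iideal) => //; lia.
have -> : j = (2 * n + 2 + 2 * ((j - (2 * n + 2)) %/ 2))%N by lia.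
by apply: (quad_in_powers char0 Iideal) => //; lia.
Qed.

(** The polynomials [t1] and [t2] are half the sum and half the difference of
   [u] and [v]. *)
Lemma quad_in_multiples j a b : quad_in I (v ^+ (2 * n + 2)) -> (2 * n + 1 <= j)%N ->
  quad_in I (v ^+ j * (T1 ^+ a * T2 ^+ b)).
Proof.
move=> IM jn; pose Q G := forall i j, (2 * n + 1 <= j)%N -> quad_in I (u ^+ i * v ^+ j * G).
have half F : quad_in I (bconst 2 * F) -> quad_in I F.
  by apply: (quad_in_unscale Iideal); exact: (natr_neq0 char0 (i := 2)).
have sc2 : bconst 2 = 2 :> B by exact: rmorph_nat.
have Q1 G : Q G -> Q (T1 * G).
  move=> QG i l ln; apply: half; rewrite sc2.
  have := quad_inD Iideal (QG i.+1 l ln) (QG i l.+1 (leqW ln)); congr (quad_in I).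
  by rewrite !exprS; move: (u ^+ _) (v ^+ _) => x y; rewrite /tsum /tdiff; ring.
have Q2 G : Q G -> Q (T2 * G).
  move=> QG i l ln; apply: half; rewrite sc2.
  have := quad_inB Iideal (QG i.+1 l ln) (QG i l.+1 (leqW ln)); congr (quad_in I).
  by rewrite !exprS; move: (u ^+ _) (v ^+ _) => x y; rewrite /tsum /tdiff; ring.
suff : Q (T1 ^+ a * T2 ^+ b) by move=> /(_ 0%N j jn); rewrite expr0 mul1r.
elim: a => [|a IHa]; last by rewrite exprS -mulrA; apply: Q1.
rewrite expr0 mul1r; elim: b => [|b IHb]; last by rewrite exprS; apply: Q2.
by move=> i l ln; rewrite expr0 mulr1; apply: quad_in_uv.
Qed.

Variable m : nat.
Hypothesis mE : m = (2 * n + 1)%N \/ m = (2 * n + 2)%N.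

(** For even [m], lowering gives [v^m] directly.  For odd [m] the leading term
   [u^(a + b) v^m] is in the ideal anyway, and the next one has coefficient
   [a - b]; this is nonzero, since for [a = b] the polynomial is antisymmetric
   and represents [0]. *)
Lemma quad_in_lowest_vector a b : quad (v ^+ m * (T1 ^+ a * T2 ^+ b)) <> 0 ->
  quad_in I (v ^+ m * (T1 ^+ a * T2 ^+ b)) -> quad_in I (v ^+ (2 * n + 2)).
Proof.
move=> nz Im; have [c [c0 c1 E]] := expand_uv k a b.
have sc2 : bconst (2 ^+ (a + b)) = 2 ^+ (a + b) :> B.
  have s2 : bconst 2 = 2 :> B by exact: rmorph_nat.
  by rewrite -[in RHS]s2; apply: rmorphXn.
have {}Im : quad_in I (\sum_(i < (a + b).+1) bconst (c i) * (u ^+ (a + b - i) * v ^+ (m + i))).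
  have := quad_inZ Iideal (2 ^+ (a + b)) Im; congr (quad_in I).
  transitivity (v ^+ m * ((u + v) ^+ a * (u - v) ^+ b)).
    have -> : u + v = 2 * T1 by rewrite /tsum /tdiff; ring.
    have -> : u - v = 2 * T2 by rewrite /tsum /tdiff; ring.
    rewrite sc2 exprD !exprMn; move: (v ^+ m) (T1 ^+ a) (T2 ^+ b) => x y z; ring.
  rewrite E mulr_sumr; apply: eq_bigr => i _; rewrite exprD.
  by move: (u ^+ _) (v ^+ m) (v ^+ i) => x y z; ring.
case: mE => mE'; last first.
  by rewrite -mE'; apply: (quad_in_lower char0 Iideal _ Im); rewrite c0 oner_neq0.
have ab : a != b.
  apply/eqP => ab; apply: nz; rewrite ab.
  have e : v ^+ m * (T1 ^+ b * T2 ^+ b) = v ^+ 2 * (v ^+ (m - 2) * (T1 ^+ b * T2 ^+ b)).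
    by rewrite [RHS]mulrA -exprD subnKC // mE'; lia.
  rewrite e; apply: quad_antisym => //; rewrite -e.
  rewrite !rmorphM !rmorphXn /= swap_tdiff swapXY_X swapXY_Y exprNn -signr_odd.
  rewrite mE' oddD oddM /= expr1 mulN1r mulNr; congr (- _); congr (_ * _).
  exact: mulrC.
have N_gt0 : (0 < a + b)%N by rewrite addn_gt0; move: ab; case: (a) (b) => [|?] [|?].
move: Im; rewrite big_ord_recl; rewrite -(prednK N_gt0) => Im.
apply: (quad_in_lower char0 Iideal (c := fun i => c i.+1) (N := (a + b).-1)).
  by rewrite c1 subr_eq0; apply/eqP => /(natr_inj char0) /eqP; apply/negP.
(* Remove the leading term, whose power of [v] is odd. *)
have odd0 : quad_in I (bconst (c 0%N) * (u ^+ (a + b) * v ^+ m)).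
  by apply/(quad_inZ Iideal)/(quad_in_odd char0 Iideal); rewrite mE' ?oddD ?oddM //; lia.
have := quad_inB Iideal Im odd0; congr (quad_in I).
rewrite prednK // subn0 addn0 addrAC subrr add0r; apply: eq_bigr => i _.
congr (_ * (_ ^+ _ * _ ^+ _)); rewrite /= /bump leq0n; lia.
Qed.

End AllDifferentiators.

Section Indices.
Variable k : fieldType.

(** The indices are shifted because [e_i] is [t^(i + 1) d/dt]. *)
Lemma differentiator_fdiff m N j : (j + m <= N)%N ->
  differentiator k m ((N - j)%:Z - 1) (j%:Z - 1)
  = fdiff m (fun i => letter k (N - i) * letter k i) j.
Proof.
move=> jmN; apply: eq_bigr => i _; have im : (i <= m)%N by rewrite -ltnS.
have -> : witt_e k ((N - j)%:Z - 1 - i%:Z) = 'X^(N - (j + i)).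
  by congr ('X^ _); lia.
have -> : witt_e k (j%:Z - 1 + i%:Z) = 'X^(j + i).
  by congr ('X^ _); lia.
rewrite -scalerMnl mulrnAl; congr (_ *+ _).
by rewrite -[in LHS]signr_odd -[in RHS]signr_odd mulr_sign scaler_sign.
Qed.

Lemma differentiator_index m (r s : int) : m%:Z - 1 <= r -> -1 <= s ->
  exists N j, [/\ (j + m <= N)%N, r = (N - j)%:Z - 1 & s = j%:Z - 1].
Proof.
move=> mr s1; exists (absz (r + 1)%R + absz (s + 1)%R)%N, (absz (s + 1)).
by split; lia.
Qed.
End Indices.

(** * The kernel as an ideal *)

Local Open Scope classical_set_scope.

Lemma left_ideal_gen_ideal (R : pzRingType) (S : set R) : left_ideal (left_ideal_gen S).
Proof.
split=> [J [] //|x y Jx Jy J JJ SJ|a x Jx J JJ SJ]; case: (JJ) => _ JD JM.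
  by apply: JD; [apply: Jx | apply: Jy].
by apply: JM; apply: Jx.
Qed.

Lemma two_sided_ideal_gen_ideal (R : pzRingType) (S : set R) :
  two_sided_ideal (two_sided_ideal_gen S).
Proof.
split=> [|x a Jx J JJ SJ]; last by case: (JJ) => _; apply; apply: Jx.
split=> [J [[] //]|x y Jx Jy J JJ SJ|a x Jx J JJ SJ]; case: (JJ) => -[_ JD JM] _.
  by apply: JD; [apply: Jx | apply: Jy].
by apply: JM; apply: Jx.
Qed.

Lemma ker_set_ideal (R S : pzRingType) (f : {rmorphism R -> S}) :
  two_sided_ideal (ker_set f).
Proof.
split=> [|x a /= fx]; last by rewrite /ker_set /= rmorphM fx mul0r.
split=> [|x y /= fx fy|a x /= fx]; rewrite /ker_set /=.
- exact: rmorph0.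
- by rewrite rmorphD fx fy addr0.
- by rewrite rmorphM fx mulr0.
Qed.

Theorem corollary1p5 (k : fieldType) (char0 : [pchar k] =i pred0)
    (n m : nat) (n_ge1 : (1 <= n)%N)
    (mE : m = (2 * n + 1)%N \/ m = (2 * n + 2)%N)
    (k0 s0 : int) (k0_ge : m%:Z - 1 <= k0) (s0_ge : -1 <= s0)
    (nz : differentiator k m k0 s0 <> 0) :
  two_sided_ideal_gen [set differentiator k m k0 s0] = ker_set (Psi k n) /\
  ker_set (Psi k n) =
    left_ideal_gen [set x | exists r s : int,
      [/\ m%:Z - 1 <= r, -1 <= s & x = differentiator k m r s]].
Proof.
have mlo : (2 * n < m)%N by case: mE => ->; lia.
have mhi : (m <= 2 * n + 2)%N by case: mE => ->; lia.
have diff_ker r s : m%:Z - 1 <= r -> -1 <= s -> Psi k n (differentiator k m r s) = 0.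
  move=> mr s1; have [N [j [jmN -> ->]]] := differentiator_index mr s1.
  by rewrite differentiator_fdiff // differentiator_orbit.
have kerI := ker_set_ideal (Psi k n).
split; apply/seteqP; split=> x.
- by apply=> // _ ->; apply: diff_ker.
- set I := two_sided_ideal_gen _ => x0.
  have I2 : two_sided_ideal I by exact: two_sided_ideal_gen_ideal.
  have I1 : left_ideal I by case: I2.
  have I0 : I (differentiator k m k0 s0) by move=> J _; apply.
  apply: (kernel_in_ideal char0 I1 _ mhi _ x0) => [N j jmN|y Iy]; last first.
    by apply: (Iy _ kerI) => _ ->; apply: diff_ker.
  have [N0 [j0 [jmN0 k0E s0E]]] := differentiator_index k0_ge s0_ge.
  move: nz I0; rewrite k0E s0E differentiator_fdiff // fdiff_quad // => nz I0.
  have IM := quad_in_lowest_vector char0 I2 n_ge1 mE nz I0.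
  have m1 : (2 * n + 1 <= m)%N by lia.
  by rewrite fdiff_quad //; exact: (quad_in_multiples char0 I2 n_ge1 (N - j - m)%N j IM m1).
- set L := left_ideal_gen _ => x0; have L1 : left_ideal L by exact: left_ideal_gen_ideal.
  apply: (kernel_in_ideal char0 L1 _ mhi _ x0) => [N j jmN|y].
  + move=> J _; apply; exists ((N - j)%:Z - 1), (j%:Z - 1).
    by split; [lia | lia | rewrite differentiator_fdiff].
  + move=> Ly; apply: (Ly (ker_set (Psi k n))); first by case: kerI.
    by move=> _ [r [s [mr s1 ->]]]; apply: diff_ker.
- move=> Lx; apply: (Lx (ker_set (Psi k n))); first by case: kerI.
  by move=> _ [r [s [mr s1 ->]]]; apply: diff_ker.
Qed.
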